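(* Let $m\in\mathbb{N}$, $\mathbf{a}=(a_1,\dots,a_{m-1})\in\{0,1\}^{m-1}$, $\boldsymbol{\sigma}=(\sigma_1,\dots,\sigma_m)\in\{0,1\}^m$ and $\mathbf{c}=(c_1,\dots,c_{m-1})\in\{0,1\}^{m-1}$. Then $$\big(L_{2,2^m}^{\mathrm{extr}}(\mathcal{P}_{\mathbf{a}}(\boldsymbol{\sigma}))\big)^2=\frac{m}{64}+\frac{1}{72}-\frac{1}{9\cdot 4^{m+2}}+\frac{1}{192}\sum_{k=1}^{m-2}a_k\big(2-2^{2k-2m+2}\big),$$ $$\big(L_{2,2^{m+1}}^{\mathrm{extr}}(\widetilde{\mathcal{P}}_{\mathbf{a}}(\boldsymbol{\sigma}))\big)^2=\frac{m+1}{24}-\frac{5}{9\cdot 4^{m+1}}-\frac{1}{2^{2m+3}}\sum_{k=1}^{m-1}a_k2^{2k},$$ and for the upper-$\mathbf{1}$-net $$\big(L_{2,2^m}^{\mathrm{extr}}(\mathcal{P}_{\mathbf{1}})\big)^2=\frac{m}{64}+\frac{1}{72}-\frac{1}{9\cdot 4^{m+2}}.$$ Moreover, for every $p\in(1,\infty)$ we have $L_{p,N}^{\mathrm{extr}}(\mathcal{P})\lesssim_p\sqrt{\log N}$ (implied constant depending only on $p$) whenever $\mathcal{P}\in\{\mathcal{P}_{\mathbf{a}}(\boldsymbol{\sigma}),\mathcal{P}_{\mathbf{c}}\}$ and $N=2^m$, or $\mathcal{P}=\widetilde{\mathcal{P}}_{\mathbf{a}}(\boldsymbol{\sigma})$ and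 $N=2^{m+1}$.
   Context: $\oplus$ denotes addition modulo 2. The point set $\mathcal{P}_{\mathbf{a}}(\boldsymbol{\sigma})$ consists of the $2^m$ points $$\Big(\frac{t_m}{2}+\frac{t_{m-1}}{2^2}+\cdots+\frac{t_1}{2^m},\ \frac{b_1}{2}+\frac{b_2}{2^2}+\cdots+\frac{b_m}{2^m}\Big),\qquad (t_1,\dots,t_m)\in\{0,1\}^m,$$ where $b_k=t_k\oplus a_kt_m\oplus\sigma_k$ for $k\in\{1,\dots,m-1\}$ and $b_m=t_m\oplus\sigma_m$ (this is the digital $(0,m,2)$-net over $\mathbb{Z}_2$ with generating matrices $C_1$ = anti-identity and $C_2$ = identity with last column replaced by $(a_1,\dots,a_{m-1},1)^\top$, with second coordinate digitally shifted by $\boldsymbol{\sigma}$). The symmetrized set is the $2^{m+1}$-element multiset $\widetilde{\mathcal{P}}_{\mathbf{a}}(\boldsymbol{\sigma})=\mathcal{P}_{\mathbf{a}}(\boldsymbol{\sigma})\cup\mathcal{P}_{\mathbf{a}}(\boldsymbol{\sigma}^* )$, where $\boldsymbol{\sigma}^*=(\sigma_1\oplus1,\dots,\sigma_m\oplus1)$; equivalently $\mathcal{P}_{\mathbf{a}}(\boldsymbol{\sigma})\cup\{(x,1-2^{-m}-y):(x,y)\in\mathcal{P}_{\mathbf{a}}(\boldsymbol{\sigma})\}$. The set $\mathcal{P}_{\mathbf{c}}$ consists of the $2^m$ points $\big(\frac{t_m}{2}+\cdots+\frac{t_1}{2^m},\ \frac{b_1}{2}+\cdots+\frac{b_m}{2^m}\big)$,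 $(t_1,\dots,t_m)\in\{0,1\}^m$, with $b_k=t_k\oplus c_k(t_{k+1}\oplus\cdots\oplus t_m)$ for $k\le m-1$ and $b_m=t_m$; $\mathcal{P}_{\mathbf{1}}$ is $\mathcal{P}_{\mathbf{c}}$ with $\mathbf{c}=(1,\dots,1)$. For an $N$-element (multi)set $\mathcal{P}=\{\mathbf{x}_0,\dots,\mathbf{x}_{N-1}\}\subseteq[0,1)^2$, $A(B,\mathcal{P})=\#\{n:\mathbf{x}_n\in B\}$, $\lambda$ is Lebesgue measure, $[\mathbf{x},\mathbf{y})=[x_1,y_1)\times[x_2,y_2)$ for $\mathbf{x}\le\mathbf{y}$ componentwise, and $$L_{p,N}^{\mathrm{extr}}(\mathcal{P})=\Big(\int_{[0,1]^2}\int_{[0,1]^2,\ \mathbf{x}\le\mathbf{y}}\big|A([\mathbf{x},\mathbf{y}),\mathcal{P})-N\lambda([\mathbf{x},\mathbf{y}))\big|^p\,d\mathbf{x}\,d\mathbf{y}\Big)^{1/p}.$$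
   Formalization: In the first formula the summand a_k(2−2^{2k−2m+2}) is corrected to a_k(1−2^{2k−2m+2}); as printed it fails whenever some a_k=1 with k≤m−2, e.g. m=3, a_1=1 gives 595/9216, not 643/9216. *)

(* Defs.v *)
From mathcomp Require Import all_boot all_order all_algebra.
From mathcomp Require Import all_classical all_reals all_analysis.

Set Implicit Arguments.
Unset Strict Implicit.
Unset Printing Implicit Defensive.

Import Order.TTheory GRing.Theory Num.Theory.
Import numFieldNormedType.Exports.

Local Open Scope classical_set_scope.
Local Open Scope ring_scope.

Section PointSets.
Variable R : realType.

(* Digit vectors are indexed from 1: [digit s k] is s_k for 1 <= k <= size s. *)
Definition digit (s : seq bool) (k : nat) : bool := nth false s k.-1.

(* The point (t_m/2 + ... + t_1/2^m, b_1/2 + ... + b_m/2^m). *)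
Definition digital_point (m : nat) (t : seq bool) (b : nat -> bool) : R * R :=
  (\sum_(1 <= k < m.+1) (digit t (m.+1 - k))%:R / 2 ^+ k,
   \sum_(1 <= k < m.+1) (b k)%:R / 2 ^+ k).

(* Multisets of points are sequences; [m.-tuple bool] ranges over {0,1}^m. *)
Definition net_a (m : nat) (a : m.-1.-tuple bool) (sigma : m.-tuple bool) :
    seq (R * R) :=
  [seq digital_point m t (fun k =>
     if (k < m)%N then digit t k (+) (digit a k && digit t m) (+) digit sigma k
     else digit t m (+) digit sigma m)
  | t : m.-tuple bool].

Definition flip (m : nat) (sigma : m.-tuple bool) : m.-tuple bool :=
  [tuple of map negb sigma].

Definition net_sym (m : nat) (a : m.-1.-tuple bool) (sigma : m.-tuple bool) :
    seq (R * R) :=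
  net_a a sigma ++ net_a a (flip sigma).

Definition net_c (m : nat) (c : m.-1.-tuple bool) : seq (R * R) :=
  [seq digital_point m t (fun k =>
     if (k < m)%N then
       digit t k (+)
         (digit c k && \big[addb/false]_(k.+1 <= j < m.+1) digit t j)
     else digit t m)
  | t : m.-tuple bool].

Definition net_1 (m : nat) : seq (R * R) := net_c [tuple of nseq m.-1 true].

Lemma size_net_a (m : nat) (a : m.-1.-tuple bool) (sigma : m.-tuple bool) :
  size (net_a a sigma) = (2 ^ m)%N.
Proof. by rewrite size_map -cardE card_tuple card_bool. Qed.

Lemma size_net_sym (m : nat) (a : m.-1.-tuple bool) (sigma : m.-tuple bool) :
  size (net_sym a sigma) = (2 ^ m.+1)%N.
Proof. by rewrite size_cat !size_net_a addnn expnS mul2n. Qed.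

Lemma size_net_c (m : nat) (c : m.-1.-tuple bool) :
  size (net_c c) = (2 ^ m)%N.
Proof. by rewrite size_map -cardE card_tuple card_bool. Qed.

End PointSets.

Notation lambda2 R := (@lebesgue_measure R \x @lebesgue_measure R)%E.

Section Discrepancy.
Variable R : realType.
Implicit Types (x y : R * R) (B : set (R * R)) (P : seq (R * R)).

Definition unit_square : set (R * R) := `[0, 1] `*` `[0, 1].

Definition le_pt x y : Prop := x.1 <= y.1 /\ x.2 <= y.2.

Definition box x y : set (R * R) := `[x.1, y.1[ `*` `[x.2, y.2[.

Definition counting_fun B P : nat := count (mem B) P.

Definition box_discr P x y : R :=
  (counting_fun (box x y) P)%:R - (size P)%:R * fine (lambda2 R (box x y)).

(* The value is taken in the extended reals, so that finiteness of the
   integral is not presupposed by the definition. *)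
Definition extr_discrepancy (p : R) P : \bar R :=
  ((\int[lambda2 R]_(y in unit_square)
     \int[lambda2 R]_(x in unit_square `&` [set x | le_pt x y])
       (`|box_discr P x y| `^ p)%:E) `^ p^-1)%E.

End Discrepancy.

(* Main.v *)
(** By bilinearity the squared extreme L2 discrepancy is a double sum of products
    of the kernel min(z,w) - zw (a Warnock formula).  For points on the grid
    (i/N, j/N) this kernel is the covariance of the indicators [i < a], [j < a]
    for a uniform in {1..N}.  Hence, up to an explicit rounding term, the double
    sum is the interaction part of the star discrepancy function D(a,b), i.e.
    what is left after removing functions of a alone and of b alone.

    For each net D(a,b) = g(a) + W(a,b), where for fixed a the function W is a
    martingale with bounded increments driven by the binary digits of b, from the
    least significant one on.  Orthogonality of the increments yields the exact
    L2 values; for the Lp bound, the functions of a cancel in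
    D(y1,y2) - D(x1,y2) - D(y1,x2) + D(x1,x2), and the exponential moments of
    W / sqrt m are bounded. *)
Require Import Defs.
From mathcomp Require Import all_boot all_order all_algebra.
From mathcomp Require Import all_classical all_reals all_analysis.
From mathcomp Require Import measurable_realfun.
From mathcomp Require Import ring lra zify.
Set Implicit Arguments.
Unset Strict Implicit.
Unset Printing Implicit Defensive.
Import Order.TTheory GRing.Theory Num.Theory.
Import numFieldNormedType.Exports.
Local Open Scope classical_set_scope.
Local Open Scope ring_scope.

(** * Integrals of sums of products over the unit square *)

(** In each net the k-th ordinate digit is t_k plus a bit psi(t_(k+1), ..., t_m), so one recursion
    on the last abscissa digit x serves all of them. The obstacle is that D alone satisfies no
    closed recursion: for x = 1 the doubled net contributes one extra point, whose ordinate
    discrepancy K enters. The combination D + B K is stable, with B replaced by (x + B) / 2 one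
    level below; this is why a parameter B in [0, 1] runs through the walk. The drift g never has to
    be evaluated, since both the interaction and the difference over the four corners remove it.
    What remains of a net is its increment coefficient theta(t, e), through two sequences over the
    lengths k: q_k, the mean of theta^2, and r_k, the mean over e of the squared mean over t. The
    squared L2 value depends only on q, r and the number w of points per column. The shift only
    changes signs and leaves both sequences alone; the vector a enters only through r;
    symmetrization changes both. *)

Lemma ge0_le_integral_subset d (T : measurableType d) (R : realType)
    (mu : {measure set T -> \bar R}) (A B : set T) (f g : T -> \bar R) :
  (forall x, A x -> (0 <= f x)%E) -> (forall x, B x -> (0 <= g x)%E) ->
  A `<=` B -> (forall x, A x -> (f x <= g x)%E) ->
  (\int[mu]_(x in A) f x <= \int[mu]_(x in B) g x)%E.
Proof.
(* The integral of a nonnegative function is a supremum over the simple functions below it, so the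
   comparison passes to integrals without measurability of f or g. *)
move=> f0 g0 AB fg; rewrite !ge0_integralE //.
apply: le_ereal_sup => _ [h hf <-]; exists h => // x.
apply: le_trans (hf x) _; rewrite /patch.
case: ifPn => [/set_mem Ax|_]; first by rewrite mem_set; [exact: fg|exact: AB].
by case: ifPn => // /set_mem /g0.
Qed.

Section Tensor.
Variable R : realType.
Notation mu := (@lebesgue_measure R).
Notation I01 := (`[0%R : R, 1%R : R]%classic).

Lemma integrable_tensor (A B : set R) (f g : R -> R) :
  measurable A -> measurable B ->
  mu.-integrable A (EFin \o f) -> mu.-integrable B (EFin \o g) ->
  (lambda2 R).-integrable (A `*` B) (fun x => (f x.1 * g x.2)%:E) /\
  (\int[lambda2 R]_(x in A `*` B) (f x.1 * g x.2)%:E =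
   (\int[mu]_(x in A) (f x)%:E) * \int[mu]_(x in B) (g x)%:E)%E.
Proof.
move=> mA mB fi gi.
(* Extension by zero puts both factors on the whole line, where Tonelli gives integrability and
   Fubini the product formula. *)
pose f' := f \_ A; pose g' := g \_ B.
have Ef : EFin \o f' = (EFin \o f) \_ A by rewrite /f' restrict_EFin.
have Eg : EFin \o g' = (EFin \o g) \_ B by rewrite /g' restrict_EFin.
have fi' : mu.-integrable setT (EFin \o f').
  by rewrite Ef; apply/integrable_restrict => //; rewrite setTI.
have gi' : mu.-integrable setT (EFin \o g').
  by rewrite Eg; apply/integrable_restrict => //; rewrite setTI.
have E : (fun x : R * R => (f x.1 * g x.2)%:E) \_ (A `*` B) =
    (fun x => (f' x.1 * g' x.2)%:E).
  apply/funext => -[x y]; rewrite /f' /g' /patch /= in_setX /=.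
  by case: (x \in A); case: (y \in B); rewrite /= ?mul0r ?mulr0.
have mf : measurable_fun setT f' by apply/measurable_EFinP; exact: measurable_int fi'.
have mg : measurable_fun setT g' by apply/measurable_EFinP; exact: measurable_int gi'.
have mfg : measurable_fun setT (fun x : R * R => (f' x.1 * g' x.2)%:E).
  apply/measurable_EFinP; apply: measurable_funM.
    exact: measurableT_comp mf measurable_fst.
  exact: measurableT_comp mg measurable_snd.
have ffin : ((\int[mu]_x (f' x)%:E) \is a fin_num)%E by exact: integrable_fin_num fi'.
have gfin : ((\int[mu]_x (g' x)%:E) \is a fin_num)%E by exact: integrable_fin_num gi'.
have fgi : (lambda2 R).-integrable setT (fun x => (f' x.1 * g' x.2)%:E).
  apply/integrable12ltyP => //=.
  have /integrableP[_ fl] := fi'; have /integrableP[_ gl] := gi'.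
  under eq_integral => x _.
    under eq_integral => y _ do rewrite normrM EFinM.
    rewrite ge0_integralZl //; last 1 first.
      by apply: measurableT_comp => //; apply: measurableT_comp.
    over.
  have gfin' : ((\int[mu]_y (`|g' y|)%:E) \is a fin_num)%E.
    by rewrite ge0_fin_numE //; exact: integral_ge0.
  rewrite -(fineK gfin') ge0_integralZr //; last 2 first.
  - by apply: measurableT_comp => //; apply: measurableT_comp.
  - by rewrite lee_fin fine_ge0 // integral_ge0.
  apply: lte_mul_pinfty; first exact: integral_ge0.
    by rewrite ge0_fin_numE //; exact: integral_ge0.
  exact: ltry.
split.
  have mAB : measurable (A `*` B) by exact: measurableX.
  rewrite -(setTI (A `*` B)).
  by apply/integrable_restrict => //; rewrite E.
rewrite integral_mkcond E -(integral12_prod_meas1 fgi) /fubini_F.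
under eq_integral => x _.
  under eq_integral => y _ do rewrite EFinM /=.
  rewrite integralZl //.
  over.
rewrite -(fineK gfin) integralZr // [in RHS]integral_mkcond -Ef.
by rewrite [X in (_ = _ * X)%E]integral_mkcond -Eg fineK.
Qed.

(** Integration data for one coordinate: x runs over the section [S y] with inner integral [psi y],
    and I is the outer integral over y. The section is [0, y] for the exact L2 values and constantly
    [0, 1] for the Lp bound. *)
Definition kern (S : R -> set R) (u : R -> R -> R) (psi : R -> R) (I : R) :=
  (forall y, 0 <= y <= 1 -> mu.-integrable (S y) (fun x => (u x y)%:E) /\
     (\int[mu]_(x in S y) (u x y)%:E = (psi y)%:E)%E) /\
  (mu.-integrable I01 (EFin \o psi) /\
   (\int[mu]_(y in I01) (psi y)%:E = I%:E)%E).

(** The four variables decouple into the pairs (x.1, y.1) and (x.2, y.2), so Fubini reduces a sum of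
    products to one-dimensional data. *)
Lemma kern_tensor (S : R -> set R) (J : Type) (s : seq J) (c : J -> R)
    (u u' : J -> R -> R -> R) (psi psi' : J -> R -> R) (I I' : J -> R) :
  (forall y, measurable (S y)) ->
  (forall j, kern S (u j) (psi j) (I j)) ->
  (forall j, kern S (u' j) (psi' j) (I' j)) ->
  (\int[lambda2 R]_(y in @unit_square R)
     \int[lambda2 R]_(x in S y.1 `*` S y.2)
       (\sum_(j <- s) c j * (u j x.1 y.1 * u' j x.2 y.2))%:E =
  (\sum_(j <- s) c j * (I j * I' j))%:E)%E.
Proof.
move=> mS ku ku'.
have mUS : measurable (@unit_square R) by exact: measurableX.
have inner y : @unit_square R y ->
    (\int[lambda2 R]_(x in S y.1 `*` S y.2)
       (\sum_(j <- s) c j * (u j x.1 y.1 * u' j x.2 y.2))%:E =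
    \sum_(j <- s) (c j)%:E * (psi j y.1 * psi' j y.2)%:E)%E.
  case: y => y1 y2 [/=]; rewrite !in_itv /= => hy1 hy2.
  have mSS : measurable (S y1 `*` S y2) by exact: measurableX.
  have h j := integrable_tensor (mS y1) (mS y2) ((ku j).1 y1 hy1).1 ((ku' j).1 y2 hy2).1.
  under eq_integral => x _.
    rewrite -sumEFin.
    under eq_bigr => j _ do rewrite EFinM.
    over.
  rewrite integral_sum //; last by move=> j; apply: integrableZl => //; exact: (h j).1.
  apply: eq_bigr => j _; rewrite integralZl //; last exact: (h j).1.
  by rewrite (h j).2 ((ku j).1 y1 hy1).2 ((ku' j).1 y2 hy2).2 EFinM.
under eq_integral => y /set_mem /inner -> do [].
have m01 := @measurable_itv R `[0%R : R, 1%R : R].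
have h j := integrable_tensor m01 m01 (ku j).2.1 (ku' j).2.1.
rewrite integral_sum //; last by move=> j; apply: integrableZl => //; exact: (h j).1.
rewrite -sumEFin; apply: eq_bigr => j _.
rewrite integralZl //; last exact: (h j).1.
by rewrite (h j).2 (ku j).2.2 (ku' j).2.2 -!EFinM.
Qed.

Lemma integral_deriv_horner (p P : {poly R}) (a b : R) : a <= b -> p = deriv P ->
  mu.-integrable `[a, b] (fun x => (p.[x])%:E) /\
  (\int[mu]_(x in `[a, b]) (p.[x])%:E = (P.[b] - P.[a])%:E)%E.
Proof.
move=> ab ->.
have cp (q : {poly R}) : continuous (horner q).
  move=> x; apply: differentiable_continuous; apply/derivable1_diffP.
  exact: ex_derive.
split.
  apply: continuous_compact_integrable; first exact: segment_compact.
  by apply: continuous_subspaceT => x; exact: cp.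
move: ab; rewrite le_eqVlt => /orP[/eqP ->|ab].
  by rewrite set_itv1 integral_set1 subrr.
rewrite (continuous_FTC2 (F := horner P) ab) //.
- by apply: continuous_subspaceT => x; exact: cp.
- split; first by move=> x _; exact: ex_derive.
  + by apply: cvg_at_right_filter; exact: cp.
  + by apply: cvg_at_left_filter; exact: cp.
- by move=> x _; rewrite derive1E; apply: derive_val.
Qed.

End Tensor.

(** * One-dimensional integrals of interval indicators and lengths *)

Section Warnock.
Variable R : realType.
Notation mu := (@lebesgue_measure R).
Notation I01 := (`[0%R : R, 1%R : R]%classic).

Definition seg (y : R) : set R := `[0, y].

(** Since a <= b, the condition b < y already places [0, a] inside [0, y]; the inner range no longer
    depends on y, and polynomial antiderivatives give both integrals. *)
Lemma kern_cut (a b : R) (p P : R -> {poly R}) (q Q : {poly R}) :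
  0 <= a -> a <= b -> b <= 1 -> (forall y, p y = deriv (P y)) ->
  (forall y, (P y).[a] - (P y).[0] = q.[y]) -> q = deriv Q ->
  kern seg (fun x y => (x <= a)%R%:R * (b < y)%R%:R * (p y).[x])
    (fun y => (b < y)%R%:R * q.[y]) (Q.[1] - Q.[b]).
Proof.
move=> a0 ab b1 pP Pq qQ; have b0 := le_trans a0 ab; split=> [y /andP[y0 y1]|].
  have [by_|yb] := ltP b y; last first.
    under eq_fun do rewrite mulr0 mul0r.
    by split; [exact: integrable0|rewrite integral0 mul0r].
  have Ecut : seg y `&` `]-oo, a]%classic = `[0, a]%classic.
    apply/seteqP; split=> x /=; rewrite /seg /= !in_itv /= ?andbT; first by move=> [/andP[-> _] ->].
    move=> /andP[-> xa]; rewrite xa; split=> //=.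
    by rewrite (le_trans xa) // (le_trans ab) // ltW.
  have Efun : (fun x => ((x <= a)%R%:R * true%:R * (p y).[x])%:E) =
      ((fun x => ((p y).[x])%:E) \_ `]-oo, a]%classic).
    apply/funext => x; rewrite /patch mem_setE in_itv /=.
    by case: ifPn => /= xa; rewrite ?mulr1 ?mul1r // !mul0r.
  have [H1 H2] := integral_deriv_horner a0 (pP y).
  rewrite Efun; split.
    apply/integrable_restrict; [exact: measurable_itv..|].
    by rewrite Ecut.
  by rewrite -integral_mkcondr Ecut H2 Pq mul1r.
have Ecut : I01 `&` `]b, +oo[%classic = `]b, 1]%classic.
  apply/seteqP; split=> x /=; rewrite !in_itv /= ?andbT.
    by move=> [/andP[_ ->] ->].
  by move=> /andP[bx ->]; rewrite bx (le_trans b0) // ltW.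
have Efun : EFin \o (fun y => (b < y)%R%:R * q.[y]) =
    ((fun y => (q.[y])%:E) \_ `]b, +oo[%classic).
  apply/funext => x; rewrite /patch mem_setE in_itv /= andbT.
  by case: ifPn => /= xa; rewrite ?mul1r // !mul0r.
have [H1 H2] := integral_deriv_horner b1 qQ.
have sub : `]b, 1]%classic `<=` `[b, 1]%classic.
  by move=> x /=; rewrite !in_itv /= => /andP[/ltW -> ->].
split.
  rewrite Efun; apply/integrable_restrict; [exact: measurable_itv..|].
  by rewrite Ecut; apply: integrableS H1.
transitivity (\int[mu]_(y in I01) (EFin \o (fun y : R => ((b < y)%R%:R * q.[y])%R)) y)%E => //.
rewrite Efun -integral_mkcondr Ecut integral_itv_obnd_cbnd //.
have mq := measurable_int _ H1.
exact: (@measurable_funS _ _ _ _ `[b,1]%classic _ _ _ sub mq).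
Qed.

Definition ramp (z x y : R) : R := (x <= z)%R%:R * (z < y)%R%:R.

(** [None] stands for the volume term: with it the discrepancy of a box is a single sum of products,
    indexed by the points and the volume alike. *)
Definition test (z : option R) (x y : R) : R :=
  if z is Some z then ramp z x y else y - x.

Definition kerI (z w : option R) : R :=
  match z, w with
  | Some z, Some w => Num.min z w * (1 - Num.max z w)
  | Some z, None | None, Some z => z * (1 - z) / 2
  | None, None => 12^-1
  end.

Definition oin (z : option R) : Prop := if z is Some z then 0 <= z <= 1 else True.

Lemma kern_test (z w : option R) : oin z -> oin w ->
  exists psi, kern seg (fun x y => test z x y * test w x y) psi (kerI z w).
Proof.
have sw (f g : R -> R -> R) psi I : (forall x y, f x y = g x y) ->
    kern seg f psi I -> kern seg g psi I.
  by move=> fg; have -> : f = g by apply/funext => x; apply/funext => y.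
have one z1 : 0 <= z1 <= 1 ->
    exists psi, kern seg (fun x y => ramp z1 x y * (y - x)) psi (z1 * (1 - z1) / 2).
  move=> /andP[z0 z1'].
  (* Antiderivatives of y - x in x, and then of z1 y - z1^2 / 2 in y. *)
  pose P y : {poly R} := y *: 'X - (2^-1) *: 'X^2.
  pose Q : {poly R} := (z1 / 2) *: 'X^2 - (z1 ^+ 2 / 2) *: 'X.
  eexists; have -> : z1 * (1 - z1) / 2 = Q.[1] - Q.[z1].
    by rewrite /Q !hornerE /=; field.
  apply: sw (kern_cut (P := P) (p := fun y => deriv (P y)) (q := deriv Q) (Q := Q)
    z0 (lexx z1) z1' _ _ _) => // [x y|y].
    by rewrite /ramp /P !poly.derivE !hornerE /=; field.
  by rewrite /P /Q !poly.derivE !hornerE /=; field.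
case: z w => [z|] [w|] //= hz hw.
- move: hz hw => /andP[z0 z1] /andP[w0 w1].
  have a0 : 0 <= Num.min z w by rewrite le_min z0.
  have b1 : Num.max z w <= 1 by rewrite ge_max z1.
  have ab : Num.min z w <= Num.max z w by rewrite ge_min le_max lexx.
  pose Q : {poly R} := Num.min z w *: 'X.
  eexists; have -> : Num.min z w * (1 - Num.max z w) = Q.[1] - Q.[Num.max z w].
    by rewrite /Q !hornerE /=; ring.
  apply: sw (kern_cut (P := fun=> 'X) (p := fun y => 1) (q := deriv Q) (Q := Q)
    a0 ab b1 _ _ _) => // [x y|y|y].
  + rewrite /ramp le_min gt_max hornerE mulr1.
    by rewrite -!mulnb !natrM; ring.
  + by rewrite poly.derivE.
  + by rewrite /Q !poly.derivE !hornerE subr0.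
- exact: one.
- have [psi h] := one _ hw; exists psi; apply: sw h => x y; exact: mulrC.
- exists (fun y => ((3^-1) *: 'X^3 : {poly R}).[y]); split=> [y /andP[y0 _]|].
    pose P : {poly R} := y ^+ 2 *: 'X - y *: 'X^2 + 3^-1 *: 'X^3.
    have [H1 H2] := integral_deriv_horner y0 (erefl (deriv P)).
    have E x : (deriv P).[x] = (y - x) * (y - x).
      by rewrite /P !poly.derivE !hornerE /=; field.
    have -> : (fun x => ((y - x) * (y - x))%:E) = (fun x => ((deriv P).[x])%:E).
      by apply/funext => x; rewrite E.
    split; [exact: H1|rewrite H2].
    by congr EFin; rewrite /P !hornerE /=; field.
  have [|H1 H2] := @integral_deriv_horner R (3^-1 *: 'X^3) (12^-1 *: 'X^4) 0 1 ler01.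
    rewrite derivZ derivXn /= -[X in _ = _ *: X]scaler_nat scalerA; congr (_ *: _); by field.
  split; first exact: H1.
  by rewrite H2; congr EFin; rewrite !hornerE /=; field.
Qed.

End Warnock.

(** * The Warnock formula for the extreme L2 discrepancy *)

Lemma big_option (R : nmodType) (I : finType) (F : option I -> R) :
  \sum_j F j = F None + \sum_i F (Some i).
Proof.
rewrite (bigD1 None) //=; congr (_ + _).
rewrite (reindex_omap Some id) /=; last by case.
by apply: eq_bigl => i; rewrite eqxx.
Qed.

Section Warnock.
Variable R : realType.
Implicit Types (P : seq (R * R)) (x y : R * R).

Lemma counting_funE (B : set (R * R)) P :
  (counting_fun B P)%:R = \sum_(p <- P) (p \in B)%:R :> R.
Proof.
rewrite /counting_fun; elim: P => [|p P IH]; first by rewrite big_nil.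
by rewrite big_cons /= natrD IH.
Qed.

Lemma lambda2_box x y : le_pt x y ->
  fine (lambda2 R (box x y)) = (y.1 - x.1) * (y.2 - x.2).
Proof.
have len (a b : R) : a <= b -> lebesgue_measure (`[a, b[%classic : set R) = (b - a)%:E.
  move=> ab; rewrite lebesgue_measure_itv /= lte_fin EFinD EFinN.
  by case: ltP => // ba; rewrite (@le_anti _ _ a b) ?ab // -EFinB subrr.
move=> [h1 h2]; rewrite /box product_measure1E //.
transitivity (fine ((y.1 - x.1)%:E * (y.2 - x.2)%:E)%E) => //.
by congr (fine (_ * _)%E); exact: len.
Qed.

Lemma in_box (p x y : R * R) :
  (p \in box x y)%:R = ramp p.1 x.1 y.1 * ramp p.2 x.2 y.2 :> R.
Proof.
rewrite /box in_setX !mem_setE /= !in_itv /= /ramp.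
by rewrite -!mulnb !natrM.
Qed.

Lemma box_discrE P x y : le_pt x y -> box_discr P x y =
  \sum_(p <- P) ramp p.1 x.1 y.1 * ramp p.2 x.2 y.2
  - (size P)%:R * ((y.1 - x.1) * (y.2 - x.2)).
Proof.
move=> xy; rewrite /box_discr counting_funE lambda2_box //; congr (_ - _).
by apply: eq_bigr => p _; rewrite in_box.
Qed.

Lemma le_pt_domain y : unit_square y ->
  @unit_square R `&` [set x | le_pt x y] = seg y.1 `*` seg y.2.
Proof.
case: y => y1 y2 [/=]; rewrite !in_itv /= => /andP[y10 y11] /andP[y20 y21].
apply/seteqP; split => -[x1 x2]; rewrite /unit_square /le_pt /seg /= !in_itv /=.
  by move=> [[/andP[-> _] /andP[-> _]] [-> ->]].
move=> [/andP[a b] /andP[c e]]; split; last by split.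
by rewrite a c (le_trans b) // (le_trans e).
Qed.

Lemma extr_discrepancyE p P : extr_discrepancy p P =
  ((\int[lambda2 R]_(y in @unit_square R) \int[lambda2 R]_(x in seg y.1 `*` seg y.2)
       (`|box_discr P x y| `^ p)%:E) `^ p^-1)%E.
Proof.
rewrite /extr_discrepancy; congr poweR; apply: eq_integral => y /set_mem Hy.
by rewrite le_pt_domain.
Qed.

Lemma sqr_extr_discrepancy P (V : R) : 0 <= V ->
  (\int[lambda2 R]_(y in @unit_square R) \int[lambda2 R]_(x in seg y.1 `*` seg y.2)
       (box_discr P x y ^+ 2)%:E = V%:E)%E ->
  (extr_discrepancy 2 P ^+ 2)%E = V%:E.
Proof.
move=> V0 HV; rewrite extr_discrepancyE.
under eq_integral => y _.
  under eq_integral => x _ do rewrite powR_mulrn // -normrX ger0_norm ?sqr_ge0 //.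
  over.
by rewrite HV poweR_EFin powR12_sqrt // -EFin_expe sqr_sqrtr.
Qed.

Definition coef P (j : option 'I_(size P)) : R := if j is Some _ then 1 else - (size P)%:R.
Definition abscissa P (j : option 'I_(size P)) : option R :=
  omap (fun i => (tnth (in_tuple P) i).1) j.
Definition ordinate P (j : option 'I_(size P)) : option R :=
  omap (fun i => (tnth (in_tuple P) i).2) j.

Lemma warnock P : {in P, forall p, unit_square p} ->
  (extr_discrepancy 2 P ^+ 2)%E =
  (\sum_(j : option 'I_(size P)) \sum_(k : option 'I_(size P))
     coef j * coef k * (kerI (abscissa j) (abscissa k) * kerI (ordinate j) (ordinate k)))%:E.
Proof.
move=> hP.
have o1 j : oin (@abscissa P j).
  case: j => [i|] //=; have := hP _ (mem_tnth i (in_tuple P)).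
  by case=> /=; rewrite !in_itv.
have o2 j : oin (@ordinate P j).
  case: j => [i|] //=; have := hP _ (mem_tnth i (in_tuple P)).
  by case=> _ /=; rewrite !in_itv.
(* Only the outer values [kerI] matter in the end; the inner integrals are picked at once for all
   pairs of indices. *)
have [psi hpsi] := choice (fun jk => kern_test (o1 jk.1) (o1 jk.2)).
have [psi' hpsi'] := choice (fun jk => kern_test (o2 jk.1) (o2 jk.2)).
set V := (X in X%:E).
have Eint : (\int[lambda2 R]_(y in @unit_square R)
    \int[lambda2 R]_(x in seg y.1 `*` seg y.2) (box_discr P x y ^+ 2)%:E = V%:E)%E.
  pose s := index_enum (option 'I_(size P) * option 'I_(size P))%type.
  pose c (jk : option 'I_(size P) * option 'I_(size P)) := coef jk.1 * coef jk.2.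
  have pairE (F : option 'I_(size P) * option 'I_(size P) -> R) :
      \sum_(jk <- s) F jk = \sum_j \sum_k F (j, k).
    by rewrite pair_big /=; apply: eq_bigr => -[].
  have := kern_tensor s c (fun y : R => @measurable_itv R `[0, y]) hpsi hpsi'.
  rewrite pairE -/V => <-.
  apply: eq_integral => y /set_mem Hy; apply: eq_integral => x.
  rewrite -le_pt_domain // => /set_mem [_ xy]; congr EFin.
  rewrite pairE /= box_discrE //.
  transitivity ((\sum_j coef j * (test (@abscissa P j) x.1 y.1 * test (ordinate j) x.2 y.2)) ^+ 2).
    congr (_ ^+ 2); rewrite big_option /= addrC mulNr; congr (_ - _).
    by rewrite big_tnth; apply: eq_bigr => i _; rewrite mul1r.
  rewrite expr2 mulr_suml; apply: eq_bigr => j _; rewrite mulr_sumr.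
  by apply: eq_bigr => k _; rewrite /c /=; ring.
apply: sqr_extr_discrepancy => //.
(* The double sum is nonnegative because it equals the integral of a square. *)
rewrite -lee_fin -Eint; apply: integral_ge0 => y _; apply: integral_ge0 => x _.
by rewrite lee_fin sqr_ge0.
Qed.
End Warnock.

(** * Digit lists and the walk driven by the ordinate digits *)

Fixpoint bits n : seq (seq bool) :=
  if n is n'.+1 then map (cons false) (bits n') ++ map (cons true) (bits n')
  else [:: [::]].

Lemma big_bits (V : nmodType) n (F : seq bool -> V) :
  \sum_(t <- bits n.+1) F t = \sum_(t <- bits n) (F (false :: t) + F (true :: t)).
Proof. by rewrite /= big_cat !big_map big_split. Qed.

Lemma mem_bits n t : (t \in bits n) = (size t == n).
Proof.
elim: n t => [|n IH] [|x t] //=.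
- by rewrite mem_cat; apply/negP => /orP[] /mapP[].
- rewrite eqSS -IH mem_cat; case: x.
    rewrite orbC mem_map; last by move=> ? ? [].
    by case: (t \in bits n) => //=; apply/negP => /mapP[].
  rewrite mem_map; last by move=> ? ? [].
  by case: (t \in bits n) => //=; apply/negP => /mapP[].
Qed.

Lemma size_bits n : size (bits n) = (2 ^ n)%N.
Proof. by elim: n => // n IH; rewrite size_cat !size_map IH expnS; lia. Qed.

(* Lists are indexed from the last digit of the abscissa, which is also the
   first digit of the ordinate. *)
Fixpoint Xval (t : seq bool) : nat := if t is x :: t' then (x + 2 * Xval t')%N else 0%N.
Fixpoint Yval (t : seq bool) : nat :=
  if t is x :: t' then (x * 2 ^ size t' + Yval t')%N else 0%N.

(** Each digit is altered by a bit that depends only on the digits after it. Both a_k t_m + sigma_k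
    and c_k (t_(k+1) + ... + t_m) are of this kind. *)
Fixpoint scramble (psi : seq bool -> bool) (t : seq bool) : seq bool :=
  if t is x :: t' then (x (+) psi t') :: scramble psi t' else [::].

Lemma size_scramble psi t : size (scramble psi t) = size t.
Proof. by elim: t => //= x t ->. Qed.

Lemma Xval_lt t : (Xval t < 2 ^ size t)%N.
Proof. by elim: t => //= x t IH; rewrite expnS; case: x; lia. Qed.

Lemma Yval_lt t : (Yval t < 2 ^ size t)%N.
Proof. by elim: t => //= x t IH; rewrite expnS; case: x; lia. Qed.

Lemma sum_Yval (V : nmodType) n (F : nat -> V) :
  \sum_(t <- bits n) F (Yval t) = \sum_(0 <= s < 2 ^ n) F s.
Proof.
elim: n F => [|n IH] F; first by rewrite expn0 big_nat1 big_seq1.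
rewrite big_bits big_split /= (big_cat_nat (n := 2 ^ n)%N) //=; last by rewrite leq_exp2l.
congr (_ + _).
  rewrite -IH; apply: eq_bigr => t _; by rewrite mul0n.
rewrite -{1}[(2 ^ n)%N]add0n big_addn.
have -> : (2 ^ n.+1 - 2 ^ n = 2 ^ n)%N by rewrite expnS; lia.
rewrite -(IH (fun s => F (s + 2 ^ n)%N)) big_seq [RHS]big_seq.
by apply: eq_bigr => t; rewrite mem_bits => /eqP ->; rewrite mul1n addnC.
Qed.

Lemma sum_Xval (V : nmodType) n (F : nat -> V) :
  \sum_(t <- bits n) F (Xval t) = \sum_(0 <= s < 2 ^ n) F s.
Proof.
elim: n F => [|n IH] F; first by rewrite expn0 big_nat1 big_seq1.
rewrite big_bits /= (IH (fun s => F (0 + 2 * s)%N + F (1 + 2 * s)%N)).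
rewrite expnS; elim: (2 ^ n)%N => [|k IHk]; first by rewrite muln0 !big_geq.
rewrite big_nat_recr //= IHk (_ : 2 * k.+1 = (2 * k).+2)%N; last by lia.
by rewrite !big_nat_recr //= addrA add0n add1n.
Qed.

(** Scrambling is triangular: for a given tail the head is either kept or flipped, so [bits n] is
    permuted. *)
Lemma sum_scramble (V : nmodType) psi n (F : seq bool -> V) :
  \sum_(t <- bits n) F (scramble psi t) = \sum_(t <- bits n) F t.
Proof.
elim: n F => [|n IH] F; first by rewrite !big_seq1.
rewrite !big_bits /= -(IH (fun t => F (false :: t) + F (true :: t))).
by apply: eq_bigr => t _; case: (psi t) => //=; rewrite addrC.
Qed.

(** * First and second moments of the walk *)

Section Walk.
Variable R : realFieldType.
Implicit Types (theta : seq bool -> seq bool -> R) (B : R) (t e : seq bool).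

Definition sg (b : bool) : R := if b then -1 else 1.

(* The part depending on [e] of D + B K, where D is the discrepancy of a net and
   K that of the single ordinate belonging to [t]; see [net_discr_walk]. *)
Fixpoint walk theta B t e : R :=
  match t, e with
  | x :: t', z :: e' => walk theta ((x%:R + B) / 2) t' e'
      + sg z * theta t' e' * (x%:R + B * sg x) / 4
  | _, _ => 0
  end.

(** The two values of the head of e give increments of opposite sign. *)
Lemma walk_sum0 theta B n t : size t = n -> \sum_(e <- bits n) walk theta B t e = 0.
Proof.
elim: n t B => [|n IH] [|x t] B //=; first by rewrite big_seq1.
move=> [/IH IHt]; rewrite big_bits /=.
rewrite (eq_bigr (fun e => walk theta ((x%:R + B) / 2) t e * 2)); last by move=> e _; rewrite /sg; field.
by rewrite -mulr_suml IHt mul0r.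
Qed.

(** Together with [cst_coef], the coordinates of the mean square of the walk in the basis 1, B^2 -
    B. Averaging B^2 - B over B / 2 and (1 + B) / 2 gives (B^2 - B) / 4 - 1/8, and the increment
    weight B / 4 or (1 - B) / 4 has mean square (B^2 - B) / 16 + 1/32, so this span is stable. *)
Fixpoint quad_coef (q : nat -> R) n : R :=
  if n is n'.+1 then quad_coef q n' / 4 + q n' / 16 else 0.

Fixpoint cst_coef (q : nat -> R) n : R :=
  if n is n'.+1 then cst_coef q n' - quad_coef q n' / 8 + q n' / 32 else 0.

(** The cross term between the shorter walk and the new increment is odd in the head of e and sums
    to zero; the squares then add, and averaging over the head of t gives the recursion of the
    coefficients. *)
Lemma walk_sqr theta (q : nat -> R) B n :
  (forall k, (k < n)%N -> \sum_(t <- bits k) \sum_(e <- bits k) theta t e ^+ 2 = 4 ^+ k * q k) ->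
  \sum_(t <- bits n) \sum_(e <- bits n) walk theta B t e ^+ 2 =
  4 ^+ n * (cst_coef q n + quad_coef q n * (B ^+ 2 - B)).
Proof.
elim: n B => [|n IH] B hq; first by rewrite !big_seq1 /=; ring.
have IH' B' := IH B' (fun k hk => hq k (ltnW hk)).
rewrite big_bits.
transitivity (\sum_(t <- bits n) (2 * (\sum_(e <- bits n) walk theta (B / 2) t e ^+ 2)
   + 2 * (\sum_(e <- bits n) walk theta ((1 + B) / 2) t e ^+ 2)
   + (B ^+ 2 + (1 - B) ^+ 2) / 8 * \sum_(e <- bits n) theta t e ^+ 2)).
  apply: eq_bigr => t _; rewrite !big_bits !mulr_sumr -!big_split /=.
  by apply: eq_bigr => e _; rewrite /sg /= ?mulr0n ?mulr1n ?add0r; field.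
rewrite !big_split -!mulr_sumr /= !IH' hq // [4 ^+ n.+1]exprS; by field.
Qed.

Fixpoint walk_mean theta e : R :=
  if e is z :: e' then
    2 * walk_mean theta e' + sg z * (\sum_(t <- bits (size e')) theta t e') / 4
  else 0.

(** The weights x + B sg x for x = 0, 1 are B and 1 - B. They add up to 1, so the sum over t forgets
    B. *)
Lemma sum_walk theta B n e : size e = n ->
  \sum_(t <- bits n) walk theta B t e = walk_mean theta e.
Proof.
elim: n e B => [|n IH] [|z e] B //=; first by rewrite big_seq1.
move=> [he]; rewrite big_bits /= he.
transitivity (\sum_(t <- bits n) walk theta (B / 2) t e
   + \sum_(t <- bits n) walk theta ((1 + B) / 2) t e
   + sg z * (\sum_(t <- bits n) theta t e) / 4).
  rewrite mulr_sumr mulr_suml -!big_split /=; apply: eq_bigr => t _.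
  by rewrite /sg /= ?mulr0n ?mulr1n ?add0r; field.
by rewrite !IH //; ring.
Qed.

Lemma walk_mean_sqr theta (r : nat -> R) n :
  (forall k, (k < n)%N ->
    \sum_(e <- bits k) (\sum_(t <- bits k) theta t e) ^+ 2 = 8 ^+ k * r k) ->
  \sum_(e <- bits n) walk_mean theta e ^+ 2 = 8 ^+ n / 64 * \sum_(0 <= k < n) r k.
Proof.
elim: n => [|n IH] hr; first by rewrite big_seq1 big_geq //=; ring.
have IH' := IH (fun k hk => hr k (ltnW hk)).
rewrite big_bits big_nat_recr //=.
transitivity (8 * (\sum_(e <- bits n) walk_mean theta e ^+ 2)
  + 1 / 8 * \sum_(e <- bits n) (\sum_(t <- bits n) theta t e) ^+ 2).
  rewrite !mulr_sumr -big_split /= big_seq [RHS]big_seq; apply: eq_bigr => e.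
  by rewrite mem_bits => /eqP ->; rewrite /sg; field.
by rewrite IH' hr // [8 ^+ n.+1]exprS; field.
Qed.

End Walk.

(** * The discrepancy of a scrambled net as drift plus walk *)

Section Net.
Variable R : realFieldType.
Implicit Types (psi : seq bool -> bool) (B : R) (t e u v : seq bool).
Local Notation sg := (@sg R).

Definition cmp v e : R := if (Yval v < Yval e)%N then 1 else -1.

Definition net_theta psi t e : R := cmp (scramble psi t) e * sg (psi t).

Definition net_count psi n (a b : nat) : R :=
  \sum_(u <- bits n) ((Xval u < a) && (Yval (scramble psi u) < b))%N%:R.

Definition net_discr psi n t e : R :=
  net_count psi n (Xval t) (Yval e) - (Xval t)%:R * (Yval e)%:R / 2 ^+ n.

(** Discrepancy of the single ordinate attached to t, that is, of the extra point counted when the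
    last abscissa digit is 1. It is carried through the induction with the multiplier B. *)
Definition tail_discr psi n t e : R :=
  (Yval (scramble psi t) < Yval e)%N%:R - (Yval e)%:R / 2 ^+ n.

Fixpoint net_drift psi B t : R :=
  if t is x :: t' then
    net_drift psi ((x%:R + B) / 2) t' + sg (psi t') * (x%:R + B * sg x) / 4
  else 0.

Lemma Xval_inj n t u : size t = n -> size u = n -> Xval t = Xval u -> t = u.
Proof.
elim: n t u => [|n IH] [|x t] [|y u] //= [ht] [hu] h.
have [xy h'] : x = y /\ Xval t = Xval u by move: h; case: x; case: y => /=; lia.
by rewrite xy (IH t u).
Qed.

Lemma uniq_bits n : uniq (bits n).
Proof.
elim: n => //= n IH; rewrite cat_uniq !map_inj_uniq ?IH /= ?andbT; try by move=> ? ? [].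
by apply/hasPn => _ /mapP[t _ ->]; apply/negP => /mapP[].
Qed.

Lemma sum_ltn (N b : nat) : (b <= N)%N -> \sum_(0 <= s < N) (s < b)%N%:R = b%:R :> R.
Proof.
move=> bN; rewrite (big_cat_nat (n := b)) //= [X in _ + X]big1_seq ?addr0; last first.
  by move=> s; rewrite mem_index_iota => /andP[_ /andP[+ _]]; case: ltnP.
rewrite big_seq (eq_bigr (fun=> 1)).
  by rewrite -big_seq big_const_nat iter_addr_0 subn0.
by move=> s; rewrite mem_index_iota => /andP[_ ->].
Qed.

(** A tail u left of t contributes both of its extensions, whose leading ordinate digits are 0 and 1
    in some order: together the comparison one level below plus z. The tail t itself contributes
    only its extension by 0, and only if x = 1; the leading ordinate digit of that point is
    [psi t]. *)
Lemma net_count_cons psi n x t z e : size t = n -> size e = n ->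
  net_count psi n.+1 (Xval (x :: t)) (Yval (z :: e)) =
  net_count psi n (Xval t) (Yval e) + z%:R * (Xval t)%:R
   + (x * (psi t * 2 ^ n + Yval (scramble psi t) < z * 2 ^ n + Yval e))%N%:R.
Proof.
move=> ht he; rewrite /net_count big_bits /= he.
have cX : \sum_(u <- bits n) (Xval u < Xval t)%N%:R = (Xval t)%:R :> R.
  rewrite (sum_Xval n (fun s => (s < Xval t)%N%:R)) sum_ltn //.
  by have := Xval_lt t; rewrite ht => /ltnW.
have tb : t \in bits n by rewrite mem_bits ht.
have single : \sum_(u <- bits n) ((u == t) *
    (x * (psi u * 2 ^ n + Yval (scramble psi u) < z * 2 ^ n + Yval e)))%N%:R =
    (x * (psi t * 2 ^ n + Yval (scramble psi t) < z * 2 ^ n + Yval e))%N%:R :> R.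
  by rewrite (bigD1_seq t) ?uniq_bits //= eqxx mul1n big1 ?addr0 // => u /negbTE ->.
rewrite -[in RHS]cX mulr_sumr -single -!big_split /= big_seq [RHS]big_seq.
apply: eq_bigr => u; rewrite mem_bits => /eqP hu.
have hs : size (scramble psi u) = n by rewrite size_scramble.
rewrite hs -natrM -!natrD; congr _%:R.
have := Yval_lt (scramble psi u); rewrite hs.
have := Yval_lt e; rewrite he => ye yu.
have -> : (u == t) = (Xval u == Xval t).
  by apply/eqP/eqP => [->//|/(Xval_inj hu ht)].
clear single; case: (psi u); case: z; case: x; rewrite /= ?mul1n ?mul0n ?add0n ?addn0 ?addn1; lia.
Qed.

(** A new leading digit halves the old discrepancy. The remainder splits into its average over z,
    which feeds the drift, and a part odd in z, which becomes the increment of the walk. *)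
Lemma digit_discr (z p : bool) n (y w : nat) : (y < 2 ^ n)%N -> (w < 2 ^ n)%N ->
  (p * 2 ^ n + y < z * 2 ^ n + w)%N%:R - (z * 2 ^ n + w)%:R / 2 ^+ n.+1 =
  ((y < w)%N%:R - w%:R / 2 ^+ n) / 2 + sg p / 4
   + sg z * (if (y < w)%N then 1 else -1) * sg p / 4 :> R.
Proof.
move=> hy hw; have n0 : 2 ^+ n != 0 :> R by rewrite expf_neq0 // pnatr_eq0.
have -> : (p * 2 ^ n + y < z * 2 ^ n + w)%N = ((p < z) || ((p == z) && (y < w)))%N.
  case: p; case: z; rewrite /= ?mul1n ?mul0n ?ltn_add2l //.
    by apply/negbTE; rewrite -leqNgt; lia.
  by rewrite ltn_addr.
rewrite natrD natrM natrX exprS /sg.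
by case: p; case: z; case: (y < w)%N; rewrite /= ?mulr0n ?mulr1n; field.
Qed.

(* The scrambled ordinates of both halves of a net are copies of the ordinates
   one level below, so each new digit adds a drift depending on [t] only plus a
   term whose sign is the new digit of the ordinate. *)
Lemma net_discr_walk psi n B t e : size t = n -> size e = n ->
  net_discr psi n t e + B * tail_discr psi n t e =
  net_drift psi B t + walk (net_theta psi) B t e.
Proof.
elim: n B t e => [|n IH] B [|x t] [|z e] //=.
  move=> _ _; rewrite /net_discr /tail_discr /net_count big_seq1 /=.
  by rewrite !(mulr0n, mul0r, mulr0, subr0, addr0).
move=> [ht] [he]; have := IH ((x%:R + B) / 2) t e ht he.
have hs : size (scramble psi t) = n by rewrite size_scramble.
have ys := Yval_lt (scramble psi t); rewrite hs in ys.
have ye := Yval_lt e; rewrite he in ye.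
have n0 : 2 ^+ n != 0 :> R by rewrite expf_neq0 // pnatr_eq0.
set k := net_drift _ _ _; set w := walk _ _ _ _ => E.
have -> : net_discr psi n.+1 (x :: t) (z :: e) = net_discr psi n t e +
    x%:R * (tail_discr psi n t e / 2 + sg (psi t) / 4 + sg z * net_theta psi t e / 4).
  rewrite /net_theta /cmp mulrA -(digit_discr z (psi t) ys ye) /net_discr net_count_cons //.
  rewrite [Xval (_ :: _)]/= [Yval (_ :: _)]/= he !natrD !natrM natrX.
  case: x {E k w} => /=; rewrite exprS; case: z => /=; rewrite ?mulr0n ?mulr1n; by field.
have -> : tail_discr psi n.+1 (x :: t) (z :: e) = tail_discr psi n t e / 2
    + sg x * (sg (psi t) + sg z * net_theta psi t e) / 4.
  rewrite /tail_discr /= hs he digit_discr // /net_theta /cmp.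
  by case: x {E k w}; case: (psi t); rewrite /sg /=; field.
have -> : k = net_discr psi n t e + (x%:R + B) / 2 * tail_discr psi n t e - w.
  by rewrite E; ring.
by field.
Qed.

End Net.

(** * Moments of the increment coefficients of each family *)

Section Moments.
Variable R : realFieldType.
Implicit Types (psi : seq bool -> bool) (t e u v : seq bool).
Local Notation sg := (@sg R).
Local Notation cmp := (@cmp R).

Lemma sg_addb a b : sg (a (+) b) = sg a * sg b.
Proof. by case: a; case: b; rewrite /sg /=; ring. Qed.

Lemma sg_sqr b : sg b ^+ 2 = 1.
Proof. by case: b; rewrite /sg /=; ring. Qed.

Lemma cmp_sqr v e : cmp v e ^+ 2 = 1.
Proof. by rewrite /cmp; case: ifP => _; ring. Qed.

Lemma cmp_cons x v z e : size v = size e ->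
  cmp (x :: v) (z :: e) = if x == z then cmp v e else - sg z.
Proof.
move=> h; have := Yval_lt v; have := Yval_lt e; rewrite /cmp /= h /sg.
case: x; case: z; rewrite /= ?mul1n ?mul0n ?ltn_add2l // => h1 h2.
  by rewrite ltnNge ifF //; apply/negbF; lia.
by rewrite ifT ?opprK // ltn_addr.
Qed.

Lemma sum_bits_cst n (c : R) : \sum_(t <- bits n) c = 2 ^+ n * c.
Proof.
elim: n => [|n IH]; first by rewrite big_seq1 mul1r.
by rewrite big_bits big_split /= IH exprS; ring.
Qed.

Lemma sum_cmp n e : size e = n ->
  \sum_(v <- bits n) cmp v e = 2 * (Yval e)%:R - 2 ^+ n.
Proof.
move=> he.
rewrite (eq_bigr (fun v => 2 * (Yval v < Yval e)%N%:R - 1)); last first.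
  by move=> v _; rewrite /cmp; case: ifP => _ /=; ring.
rewrite sumrB -mulr_sumr (sum_Yval n (fun s => (s < Yval e)%N%:R)) sum_ltn; last first.
  by have := Yval_lt e; rewrite he => /ltnW.
by rewrite sum_bits_cst mulr1.
Qed.

Lemma sum_cmp_sqr n :
  \sum_(e <- bits n) (2 * (Yval e)%:R - 2 ^+ n) ^+ 2 =
  8 ^+ n * (1 / 3 + 2 / (3 * 4 ^+ n)) :> R.
Proof.
rewrite (sum_Yval n (fun s => (2 * s%:R - 2 ^+ n) ^+ 2)).
have gen (N : R) k : \sum_(0 <= s < k) (2 * s%:R - N) ^+ 2 =
    4 * (k%:R - 1) * k%:R * (2 * k%:R - 1) / 6 - 2 * N * k%:R * (k%:R - 1) + k%:R * N ^+ 2.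
  elim: k => [|k IH]; first by rewrite big_geq //; field.
  by rewrite big_nat_recr //= IH -natr1; field.
rewrite gen natrX.
have -> : 8 ^+ n = 2 ^+ n * (2 ^+ n) ^+ 2 :> R.
  by rewrite exprAC -exprMn; congr (_ ^+ _); ring.
have -> : 4 ^+ n = (2 ^+ n) ^+ 2 :> R by rewrite exprAC; congr (_ ^+ _); ring.
have : 2 ^+ n != 0 :> R by rewrite expf_neq0 // pnatr_eq0.
by set N := 2 ^+ n => N0; field.
Qed.

Lemma sum_cmp_head n z e : size e = n ->
  \sum_(v <- bits n.+1) cmp v (z :: e) * sg (head false v) =
  if z then 2 * (2 ^+ n - (Yval e)%:R) else 2 * (Yval e)%:R.
Proof.
move=> he; rewrite big_bits big_split /=.
have E x : \sum_(v <- bits n) cmp (x :: v) (z :: e) * sg x =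
    (if x == z then 2 * (Yval e)%:R - 2 ^+ n else - sg z * 2 ^+ n) * sg x.
  rewrite -mulr_suml; congr (_ * _).
  transitivity (\sum_(v <- bits n) if x == z then cmp v e else - sg z).
    by rewrite big_seq [RHS]big_seq; apply: eq_bigr => v;
      rewrite mem_bits => /eqP hv; rewrite cmp_cons // hv.
  by case: (x == z); rewrite ?sum_cmp // sum_bits_cst mulrC.
by rewrite !E; case: z {E}; rewrite /sg /=; ring.
Qed.

(** Up to sign these are the sums of [sum_cmp] with the halves z = 0 and z = 1 interchanged, hence
    the same second moment as in [sum_cmp_sqr]. This is why the upper-1-net has the L2 value of the
    net with a = 0. *)
Lemma sum_cmp_head_sqr n :
  \sum_(e <- bits n.+1) (\sum_(v <- bits n.+1) cmp v e * sg (head false v)) ^+ 2 =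
  8 ^+ n.+1 * (1 / 3 + 2 / (3 * 4 ^+ n.+1)) :> R.
Proof.
rewrite big_bits.
rewrite (eq_big_seq (fun e => (2 * (Yval e)%:R) ^+ 2 + (2 * (2 ^+ n - (Yval e)%:R)) ^+ 2)); last first.
  by move=> e; rewrite mem_bits => /eqP he; rewrite !sum_cmp_head.
rewrite (sum_Yval n (fun s => (2 * s%:R) ^+ 2 + (2 * (2 ^+ n - s%:R)) ^+ 2)).
have gen (N : R) k : \sum_(0 <= s < k) ((2 * s%:R) ^+ 2 + (2 * (N - s%:R)) ^+ 2) =
    8 * (k%:R - 1) * k%:R * (2 * k%:R - 1) / 6 - 4 * N * k%:R * (k%:R - 1) + 4 * k%:R * N ^+ 2.
  elim: k => [|k IH]; first by rewrite big_geq //; field.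
  by rewrite big_nat_recr //= IH -natr1; field.
rewrite gen natrX.
have -> : 8 ^+ n.+1 = 8 * (2 ^+ n * (2 ^+ n) ^+ 2) :> R.
  by rewrite exprS exprAC -exprMn; congr (_ * _ ^+ _); ring.
have -> : 4 ^+ n.+1 = 4 * (2 ^+ n) ^+ 2 :> R by rewrite exprS exprAC; congr (_ * _ ^+ _); ring.
have : 2 ^+ n != 0 :> R by rewrite expf_neq0 // pnatr_eq0.
by set N := 2 ^+ n => N0; field.
Qed.

Lemma sum_sg_last n : \sum_(v <- bits n.+1) sg (last false v) = 0.
Proof.
elim: n => [|n IH]; first by rewrite big_bits big_seq1 /sg /=; ring.
rewrite big_bits big_split /=.
have E x : \sum_(v <- bits n.+1) sg (last x v) = \sum_(v <- bits n.+1) sg (last false v).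
  by rewrite big_seq [RHS]big_seq; apply: eq_bigr => -[|y v]; rewrite mem_bits.
by rewrite !E IH addr0.
Qed.

(** Two lists that differ only in the last digit cancel unless the threshold e separates them; this
    happens for one pair at most, and exactly when e ends in 1. *)
Lemma sum_cmp_last n e : size e = n.+1 ->
  \sum_(v <- bits n.+1) cmp v e * sg (last false v) = 2 * (last false e)%:R.
Proof.
elim: n e => [|n IH] [|z e] // /succn_inj he.
  move/size0nil: he => ->; rewrite big_bits big_seq1 /= !cmp_cons // /cmp /=.
  by case: z; rewrite /sg /= ?mulr0n; ring.
have -> : last false (z :: e) = last false e by case: e he {IH}.
have E x : \sum_(v <- bits n.+1) cmp (x :: v) (z :: e) * sg (last false (x :: v)) =
    if x == z then \sum_(v <- bits n.+1) cmp v e * sg (last false v) else 0.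
  rewrite (eq_big_seq (fun v => (if x == z then cmp v e else - sg z) * sg (last false v))).
    by case: (x == z); rewrite // -mulr_sumr sum_sg_last mulr0.
  move=> v; rewrite mem_bits => /eqP hv; rewrite cmp_cons // ?hv //.
  by case: v hv.
rewrite -(IH e he) big_bits big_split !E.
by case: z {E}; rewrite /= ?add0r ?addr0.
Qed.

Lemma sum_last_sqr n : \sum_(e <- bits n.+1) ((last false e)%:R : R) ^+ 2 = 2 ^+ n.
Proof.
elim: n => [|n IH]; first by rewrite big_bits big_seq1 /= mulr0n; ring.
rewrite big_bits big_split /=.
have E x : \sum_(v <- bits n.+1) ((last x v)%:R : R) ^+ 2 =
    \sum_(v <- bits n.+1) (last false v)%:R ^+ 2.
  by rewrite big_seq [RHS]big_seq; apply: eq_bigr => -[|y v]; rewrite mem_bits.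
by rewrite !E IH exprS; ring.
Qed.

Lemma last_scramble psi x t :
  last false (scramble psi (x :: t)) = last false (x :: t) (+) psi [::].
Proof. by elim: t x => //= y t IH x; exact: IH. Qed.

Lemma scramble_negb psi t : scramble (fun t => ~~ psi t) t = map negb (scramble psi t).
Proof. by elim: t => //= x t ->; rewrite addbN. Qed.

(* A list of size n holds t_(m-n+1), ..., t_m, so that [A n] and [S n] stand for
   a_(m-n) and sigma_(m-n). *)
Definition psi_a (A S : nat -> bool) t := (A (size t) && last false t) (+) S (size t).

Lemma theta_sqr psi n :
  \sum_(t <- bits n) \sum_(e <- bits n) net_theta R psi t e ^+ 2 = 4 ^+ n.
Proof.
under eq_bigr => t _ do
  (under eq_bigr => e _ do rewrite /net_theta exprMn cmp_sqr sg_sqr mulr1; rewrite sum_bits_cst).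
rewrite sum_bits_cst mulr1 -exprMn; congr (_ ^+ _); ring.
Qed.

(** If [A n] holds, the sign of [psi_a] is a character in the last digit t_m, which scrambling
    changes only by the constant [S 0]. Otherwise the sign is constant in t and the sum is a plain
    count. For n = 0 there is no last digit, hence the guard. *)
Lemma sum_theta_a A S n e : size e = n ->
  \sum_(t <- bits n) net_theta R (psi_a A S) t e =
  sg (S n) * if A n && (0 < n)%N then sg (S 0%N) * (2 * (last false e)%:R)
             else 2 * (Yval e)%:R - 2 ^+ n.
Proof.
move=> he; rewrite /net_theta.
have sgE t : t \in bits n -> sg (psi_a A S t) = sg (S n) * if A n then sg (last false t) else 1.
  rewrite mem_bits => /eqP ht; rewrite /psi_a ht sg_addb mulrC; congr (_ * _).
  by case: (A n).
rewrite (eq_big_seq (fun t => sg (S n) * (cmp (scramble (psi_a A S) t) e *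
    if A n then sg (last false t) else 1))); last first.
  by move=> t /sgE ->; rewrite mulrCA.
rewrite -mulr_sumr; congr (_ * _).
case: (A n); rewrite (andTb, andFb); last first.
  under eq_bigr do rewrite mulr1.
  by rewrite (sum_scramble _ n (fun v => cmp v e)) sum_cmp.
case: n he {sgE} => [|n] he; rewrite ?ltn0Sn ?ltnn.
  by move/size0nil: he => ->; rewrite big_seq1 /cmp /= /sg; ring.
rewrite -(sum_cmp_last he) -(sum_scramble (psi_a A S) _ (fun v => cmp v e * sg (last false v))).
rewrite mulr_sumr; apply: eq_big_seq => -[|x t]; rewrite mem_bits // => _.
rewrite last_scramble sg_addb /psi_a [(_ && _) (+) _]/= andbF addFb.
have := sg_sqr (S 0%N); rewrite expr2 => h.
by rewrite -[LHS]mulr1 -h; ring.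
Qed.

Lemma theta_a_mean A S n :
  \sum_(e <- bits n) (\sum_(t <- bits n) net_theta R (psi_a A S) t e) ^+ 2 =
  8 ^+ n * if A n && (0 < n)%N then 2 / 4 ^+ n else 1 / 3 + 2 / (3 * 4 ^+ n).
Proof.
rewrite (eq_big_seq (fun e => (if A n && (0 < n)%N then (2 * (last false e)%:R)
             else 2 * (Yval e)%:R - 2 ^+ n) ^+ 2)); last first.
  move=> e; rewrite mem_bits => /eqP he; rewrite sum_theta_a // exprMn sg_sqr mul1r.
  by case: ifP => // _; rewrite exprMn sg_sqr mul1r.
case: ifP => [/andP[_]|_]; last exact: sum_cmp_sqr.
case: n => // n _; under eq_bigr do rewrite exprMn.
rewrite -mulr_sumr sum_last_sqr.
have -> : 8 ^+ n.+1 = 4 ^+ n.+1 * 2 ^+ n.+1 :> R by rewrite -exprMn; congr (_ ^+ _); ring.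
have : 4 ^+ n.+1 != 0 :> R by rewrite expf_neq0 // pnatr_eq0.
by move=> h; rewrite [2 ^+ n.+1]exprS; field.
Qed.

Definition parity t := foldr addb false t.

(** The sign attached to t is thus a function of the scrambled list alone, so the column sums for
    parity become sums over v. *)
Lemma head_scramble_parity t : head false (scramble parity t) = parity t.
Proof. by case: t. Qed.

Lemma theta_parity_mean n :
  \sum_(e <- bits n) (\sum_(t <- bits n) net_theta R parity t e) ^+ 2 =
  8 ^+ n * (1 / 3 + 2 / (3 * 4 ^+ n)).
Proof.
have E e : \sum_(t <- bits n) net_theta R parity t e =
    \sum_(v <- bits n) cmp v e * sg (head false v).
  rewrite -(sum_scramble parity n (fun v => cmp v e * sg (head false v))).
  by apply: eq_bigr => t _; rewrite head_scramble_parity.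
under eq_bigr do rewrite E.
case: n {E} => [|n]; last exact: sum_cmp_head_sqr.
by rewrite !big_seq1 /cmp /sg /=; field.
Qed.

Definition sym_theta psi t e :=
  net_theta R psi t e + net_theta R (fun t => ~~ psi t) t e.

Lemma sym_thetaE psi t e : sym_theta psi t e =
  sg (psi t) * (cmp (scramble psi t) e - cmp (map negb (scramble psi t)) e).
Proof.
rewrite /sym_theta /net_theta scramble_negb.
by case: (psi t); rewrite /sg /=; ring.
Qed.

(** A squared term is 4 if e separates v from its complement and 0 otherwise. For fixed tails,
    exactly two of the four choices of leading digits of v and e give a separation. For n = 0 the
    list v is its own complement. *)
Lemma sym_theta_sqr psi n :
  \sum_(t <- bits n) \sum_(e <- bits n) sym_theta psi t e ^+ 2 =
  4 ^+ n * if (0 < n)%N then 2 else 0.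
Proof.
under eq_bigr => t _ do under eq_bigr => e _ do rewrite sym_thetaE exprMn sg_sqr mul1r.
rewrite (sum_scramble psi n (fun v => \sum_(e <- bits n) (cmp v e - cmp (map negb v) e) ^+ 2)).
case: n => [|n]; first by rewrite !big_seq1 /= subrr expr0n mulr0.
rewrite big_bits /= (eq_big_seq (fun v => 2 ^+ n * 8)).
  rewrite sum_bits_cst mulrA -exprMn exprS (_ : 2 * 2 = 4) //; by [ring | rewrite -natrM].
move=> v; rewrite mem_bits => /eqP hv.
rewrite -sum_bits_cst -big_split /= big_bits; apply: eq_big_seq => e.
rewrite mem_bits => /eqP he; rewrite !cmp_cons ?size_map ?hv ?he //=.
by rewrite /sg /= /cmp; case: ifP => _; case: ifP => _; ring.
Qed.

(** Complementing sigma flips both [sg (S n)] and [sg (S 0)]. If [A n] holds the flips compensate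
    and the column sum doubles; otherwise only the first sign occurs and the two halves cancel. *)
Lemma theta_sym_mean A S n :
  \sum_(e <- bits n) (\sum_(t <- bits n) sym_theta (psi_a A S) t e) ^+ 2 =
  8 ^+ n * if A n && (0 < n)%N then 8 / 4 ^+ n else 0.
Proof.
rewrite (eq_big_seq (fun e => if A n && (0 < n)%N then 4 * (2 * (last false e)%:R) ^+ 2
             else 0)); last first.
  move=> e; rewrite mem_bits => /eqP he; rewrite big_split /=.
  have -> : \sum_(t <- bits n) net_theta R (fun t => ~~ psi_a A S t) t e =
      \sum_(t <- bits n) net_theta R (psi_a A (fun k => ~~ S k)) t e.
    have sc t : scramble (fun t => ~~ psi_a A S t) t = scramble (psi_a A (fun k => ~~ S k)) t.
      by elim: t => //= x t ->; rewrite /psi_a -!addbN.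
    by apply: eq_bigr => t _; rewrite /net_theta sc /psi_a -!addbN.
  rewrite !sum_theta_a //; have sN b : sg (~~ b) = - sg b by case: b; rewrite /sg /= ?opprK.
  rewrite !sN; case: ifP => _.
    have := sg_sqr (S n); have := sg_sqr (S 0%N).
    set a := sg _; set b := sg _; set l := 2 * _ => h1 h2.
    have -> : (b * (a * l) + - b * (- a * l)) ^+ 2 = 4 * (a ^+ 2 * b ^+ 2 * l ^+ 2) by ring.
    by rewrite h1 h2 !mul1r.
  by rewrite mulNr subrr expr0n.
case: ifP => [/andP[_]|_]; last by rewrite big1 ?mulr0.
case: n => // n _; under eq_bigr do rewrite exprMn mulrA.
rewrite -mulr_sumr sum_last_sqr.
have -> : 8 ^+ n.+1 = 4 ^+ n.+1 * 2 ^+ n.+1 :> R by rewrite -exprMn; congr (_ ^+ _); ring.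
have : 4 ^+ n.+1 != 0 :> R by rewrite expf_neq0 // pnatr_eq0.
by move=> h; rewrite [2 ^+ n.+1]exprS; field.
Qed.

End Moments.

(** * From the Warnock sum to the moments of the walk *)

Section Anova.
Variables (R : realType) (N : nat).
Hypothesis N0 : (0 < N)%N.

Let N0r : N%:R != 0 :> R.
Proof. by rewrite pnatr_eq0 -lt0n. Qed.

Definition mean (f : nat -> R) : R := (\sum_(1 <= a < N.+1) f a) / N%:R.

Definition covar (f h : nat -> R) : R := mean (fun a => f a * h a) - mean f * mean h.

Lemma mean_sum (J : Type) (s : seq J) (f : J -> nat -> R) :
  mean (fun a => \sum_(j <- s) f j a) = \sum_(j <- s) mean (f j).
Proof. by rewrite /mean exchange_big /= mulr_suml. Qed.

Lemma meanZ c (f : nat -> R) : mean (fun a => c * f a) = c * mean f.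
Proof. by rewrite /mean -mulr_sumr mulrA. Qed.

Lemma eq_mean (f h : nat -> R) : f =1 h -> mean f = mean h.
Proof. by move=> fh; congr (_ / _); apply: eq_bigr => a _. Qed.

(** Means run over 1, ..., N while digit lists encode 0, ..., N - 1. The discrepancy function
    vanishes at both ends, so it does not see the difference. *)
Lemma mean_shift (f : nat -> R) : f 0%N = f N ->
  mean f = (\sum_(0 <= a < N) f a) / N%:R.
Proof.
move=> fN; rewrite /mean big_nat_recr //= -fN addrC; congr (_ / _).
by rewrite [RHS]big_ltn //.
Qed.

Lemma mean2 (J : Type) (s : seq J) (c : J -> R) (F H : J -> nat -> R) :
  mean (fun a => mean (fun b => \sum_(j <- s) c j * (F j a * H j b))) =
  \sum_(j <- s) c j * (mean (F j) * mean (H j)).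
Proof.
rewrite (eq_mean (h := fun a => \sum_(j <- s) c j * mean (H j) * F j a)).
  by rewrite mean_sum; apply: eq_bigr => j _; rewrite meanZ; ring.
move=> a; rewrite mean_sum; apply: eq_bigr => j _.
by rewrite -meanZ mulrC -meanZ; apply: eq_mean => b; ring.
Qed.

Definition interaction (D : nat -> nat -> R) : R :=
  mean (fun a => mean (fun b => D a b ^+ 2)) - mean (fun a => mean (D a) ^+ 2)
  - mean (fun b => mean (D ^~ b) ^+ 2) + mean (fun a => mean (D a)) ^+ 2.

Lemma interaction_covar (J : finType) (c : J -> R) (f h : J -> nat -> R) :
  interaction (fun a b => \sum_j c j * (f j a * h j b)) =
  \sum_j \sum_k c j * c k * (covar (f j) (f k) * covar (h j) (h k)).
Proof.
pose s := index_enum (J * J)%type.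
have pairE (F : J * J -> R) : \sum_(jk <- s) F jk = \sum_j \sum_k F (j, k).
  by rewrite pair_big /=; apply: eq_bigr => -[].
have sqrE (x : J -> R) : (\sum_j x j) ^+ 2 = \sum_(jk <- s) x jk.1 * x jk.2.
  rewrite pairE expr2 mulr_suml; apply: eq_bigr => j _.
  by rewrite mulr_sumr.
rewrite /interaction.
have -> : mean (fun a => mean (fun b => (\sum_j c j * (f j a * h j b)) ^+ 2)) =
    \sum_(p <- s) c p.1 * c p.2 *
      (mean (fun a => f p.1 a * f p.2 a) * mean (fun b => h p.1 b * h p.2 b)).
  rewrite -(mean2 s (fun p => c p.1 * c p.2) (fun p a => f p.1 a * f p.2 a)
    (fun p b => h p.1 b * h p.2 b)).
  apply: eq_mean => a; apply: eq_mean => b; rewrite sqrE.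
  by apply: eq_bigr => p _; ring.
have mh a : mean (fun b => \sum_j c j * (f j a * h j b)) = \sum_j c j * mean (h j) * f j a.
  rewrite mean_sum; apply: eq_bigr => j _.
  by rewrite mulrAC -meanZ; apply: eq_mean => b; ring.
have mf b : mean (fun a => \sum_j c j * (f j a * h j b)) = \sum_j c j * mean (f j) * h j b.
  rewrite mean_sum; apply: eq_bigr => j _.
  by rewrite mulrAC -meanZ; apply: eq_mean => a; ring.
have -> : mean (fun a => mean (fun b => \sum_j c j * (f j a * h j b)) ^+ 2) =
    \sum_(p <- s) c p.1 * c p.2 *
      (mean (fun a => f p.1 a * f p.2 a) * (mean (h p.1) * mean (h p.2))).
  transitivity (mean (fun a => \sum_(p <- s)
      (c p.1 * c p.2 * (mean (h p.1) * mean (h p.2))) * (f p.1 a * f p.2 a))).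
    by apply: eq_mean => a; rewrite mh sqrE; apply: eq_bigr => p _; ring.
  by rewrite mean_sum; apply: eq_bigr => p _; rewrite meanZ; ring.
have -> : mean (fun b => mean (fun a => \sum_j c j * (f j a * h j b)) ^+ 2) =
    \sum_(p <- s) c p.1 * c p.2 *
      ((mean (f p.1) * mean (f p.2)) * mean (fun b => h p.1 b * h p.2 b)).
  transitivity (mean (fun b => \sum_(p <- s)
      (c p.1 * c p.2 * (mean (f p.1) * mean (f p.2))) * (h p.1 b * h p.2 b))).
    by apply: eq_mean => b; rewrite mf sqrE; apply: eq_bigr => p _; ring.
  by rewrite mean_sum; apply: eq_bigr => p _; rewrite meanZ; ring.
have -> : mean (fun a => mean (fun b => \sum_j c j * (f j a * h j b))) ^+ 2 =
    \sum_(p <- s) c p.1 * c p.2 *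
      ((mean (f p.1) * mean (f p.2)) * (mean (h p.1) * mean (h p.2))).
  rewrite (eq_mean mh) mean_sum sqrE; apply: eq_bigr => p _.
  by rewrite !meanZ; ring.
rewrite -!sumrB -big_split /= pairE.
by apply: eq_bigr => j _; apply: eq_bigr => k _; rewrite /covar /=; ring.
Qed.

Definition feature (x : option nat) (a : nat) : R :=
  if x is Some i then (i < a)%N%:R else a%:R / N%:R.

Lemma mean_gt i : (i <= N)%N -> mean (fun a => (i < a)%N%:R) = 1 - i%:R / N%:R.
Proof.
move=> iN; rewrite /mean (big_cat_nat (n := i.+1)) //= big1_seq ?add0r; last first.
  by move=> a; rewrite mem_index_iota ltnS => /andP[_ /andP[_]]; case: ltnP.
rewrite big_seq (eq_bigr (fun=> 1)); last first.
  by move=> a; rewrite mem_index_iota => /andP[-> _].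
rewrite -big_seq big_const_nat iter_addr_0 subSS natrB //.
by field.
Qed.

Lemma sum_id k : \sum_(1 <= a < k.+1) (a%:R : R) = k%:R * (k%:R + 1) / 2.
Proof.
elim: k => [|k IH]; first by rewrite big_geq //; field.
by rewrite big_nat_recr //= IH -natr1; field.
Qed.

Lemma sum_id_sqr k :
  \sum_(1 <= a < k.+1) (a%:R ^+ 2 : R) = k%:R * (k%:R + 1) * (2 * k%:R + 1) / 6.
Proof.
elim: k => [|k IH]; first by rewrite big_geq //; field.
by rewrite big_nat_recr //= IH -natr1; field.
Qed.

Lemma mean_id : mean (fun a => a%:R / N%:R) = (N%:R + 1) / (2 * N%:R).
Proof. by rewrite /mean -mulr_suml sum_id; field. Qed.

Lemma mean_gt_id i : (i <= N)%N -> mean (fun a => (i < a)%N%:R * (a%:R / N%:R)) =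
  (N%:R * (N%:R + 1) - i%:R * (i%:R + 1)) / (2 * N%:R ^+ 2).
Proof.
move=> iN; rewrite /mean (big_cat_nat (n := i.+1)) //= big1_seq ?add0r; last first.
  by move=> a; rewrite mem_index_iota ltnS => /andP[_ /andP[_]]; case: ltnP; rewrite ?mul0r.
rewrite big_seq (eq_bigr (fun a => a%:R / N%:R)); last first.
  by move=> a; rewrite mem_index_iota => /andP[-> _]; rewrite mul1r.
rewrite -big_seq -mulr_suml.
have := sum_id N; rewrite (big_cat_nat (n := i.+1)) //= sum_id => h.
have -> : \sum_(i.+1 <= a < N.+1) (a%:R : R) = N%:R * (N%:R + 1) / 2 - i%:R * (i%:R + 1) / 2.
  by rewrite -h; ring.
by field.
Qed.

Definition grid_coord (x : option nat) : option R := omap (fun i => i%:R / N%:R) x.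

Definition ongrid (x : option nat) : bool := if x is Some i then (i < N)%N else true.

(** All entries agree exactly except the one for volume against volume: the variance of a / N is
    (N^2 - 1) / (12 N^2), which falls short of 1/12 by 1 / (12 N^2). *)
Lemma kerI_covar x y : ongrid x -> ongrid y ->
  kerI (grid_coord x) (grid_coord y) = covar (feature x) (feature y)
    + (if x is None then if y is None then (12 * N%:R ^+ 2)^-1 else 0 else 0).
Proof.
have one i : (i < N)%N -> i%:R / N%:R * (1 - i%:R / N%:R) / 2 =
    covar (feature (Some i)) (feature None).
  move=> iN; rewrite /covar /feature mean_gt_id ?mean_gt ?mean_id; try exact: ltnW.
  by field.
case: x y => [i|] [j|] //= hi hj; rewrite ?addr0.
- rewrite /covar /feature.
  have -> : mean (fun a => (i < a)%N%:R * (j < a)%N%:R) = 1 - (maxn i j)%:R / N%:R.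
    rewrite -mean_gt; last by rewrite geq_max ltnW // ltnW.
    by apply: eq_mean => a; rewrite gtn_max -mulnb natrM.
  rewrite !mean_gt; try exact: ltnW.
  case: (leqP i j) => ij; last move: ij => /ltnW ij.
    have h : i%:R / N%:R <= j%:R / N%:R :> R by rewrite ler_wpM2r // ler_nat.
    by rewrite (min_idPl h) (max_idPr h); ring.
  have h : j%:R / N%:R <= i%:R / N%:R :> R by rewrite ler_wpM2r // ler_nat.
  by rewrite (min_idPr h) (max_idPl h); ring.
- exact: one.
- rewrite one // /covar [mean (feature None) * _]mulrC; congr (_ - _).
  by apply: eq_mean => a; rewrite mulrC.
- rewrite /covar /feature mean_id.
  have -> : mean (fun a => a%:R / N%:R * (a%:R / N%:R)) =
      (N%:R + 1) * (2 * N%:R + 1) / (6 * N%:R ^+ 2).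
    rewrite (eq_mean (h := fun a => (N%:R ^+ 2)^-1 * a%:R ^+ 2)); last by move=> a; field.
    by rewrite meanZ /mean sum_id_sqr; field.
  by field.
Qed.
End Anova.

Lemma big_option2 (V : zmodType) (I : finType) (F G : option I -> option I -> V) :
  (forall j k, j != None \/ k != None -> F j k = G j k) ->
  \sum_j \sum_k F j k = \sum_j \sum_k G j k + (F None None - G None None).
Proof.
move=> FG; rewrite !big_option.
rewrite [X in _ + X + _](eq_bigr (fun k => G None (Some k))); last first.
  by move=> k _; apply: FG; right.
rewrite [X in _ + _ + X](eq_bigr (fun j => \sum_k G (Some j) k)); last first.
  by move=> j _; apply: eq_bigr => k _; apply: FG; left.
set A := \sum_i G None _; set B := \sum_i \sum_k _.
by rewrite [RHS]addrC -[in RHS](addrA (G None None)) [RHS]addrA subrK addrA.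
Qed.

(** * The exact L2 value of a net on the grid *)

Section GridNet.
Variable R : realType.

Definition grid_points (n : nat) (Q : seq (nat * nat)) : seq (R * R) :=
  [seq (q.1%:R / 2 ^+ n, q.2%:R / 2 ^+ n) | q <- Q].

(* [w] is the number of points in each of the 2^n columns and rows. *)
Record grid_net (n : nat) (Q : seq (nat * nat)) (w : R)
    (theta : seq bool -> seq bool -> R) (g : seq bool -> R) : Prop := GridNet {
  net_size : (size Q)%:R = w * 2 ^+ n;
  net_range : forall q, q \in Q -> (q.1 < 2 ^ n)%N && (q.2 < 2 ^ n)%N;
  net_cols : forall a, (a <= 2 ^ n)%N -> \sum_(q <- Q) (q.1 < a)%N%:R = w * a%:R;
  net_rows : forall b, (b <= 2 ^ n)%N -> \sum_(q <- Q) (q.2 < b)%N%:R = w * b%:R;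
  net_walk : forall t e, size t = n -> size e = n ->
    \sum_(q <- Q) ((q.1 < Xval t) && (q.2 < Yval e))%N%:R
      - w * (Xval t)%:R * (Yval e)%:R / 2 ^+ n = g t + walk theta 0 t e }.

Definition grid_discr n (Q : seq (nat * nat)) (w : R) (a b : nat) : R :=
  \sum_(q <- Q) ((q.1 < a) && (q.2 < b))%N%:R - w * a%:R * b%:R / 2 ^+ n.

(** The walk has mean zero in b, so the row means are g and removing them leaves the mean square of
    the walk, which at B = 0 is [cst_coef q n]. The column means vary through [walk_mean], with
    variance (sum of r) / 64. *)
Lemma interaction_walk n (D : nat -> nat -> R) theta g (q r : nat -> R) :
  (forall b, D 0%N b = 0) -> (forall a, D a 0%N = 0) ->
  (forall b, (b <= 2 ^ n)%N -> D (2 ^ n)%N b = 0) ->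
  (forall a, (a <= 2 ^ n)%N -> D a (2 ^ n)%N = 0) ->
  (forall t e, size t = n -> size e = n -> D (Xval t) (Yval e) = g t + walk theta 0 t e) ->
  (forall k, \sum_(t <- bits k) \sum_(e <- bits k) theta t e ^+ 2 = 4 ^+ k * q k) ->
  (forall k, \sum_(e <- bits k) (\sum_(t <- bits k) theta t e) ^+ 2 = 8 ^+ k * r k) ->
  interaction (2 ^ n) D = cst_coef q n - (\sum_(0 <= k < n) r k) / 64.
Proof.
move=> D0 D0' DN DN' hD hq hr.
have N0 : (0 < 2 ^ n)%N by rewrite expn_gt0.
pose N : R := (2 ^ n)%:R.
have NE : N = 2 ^+ n by rewrite /N natrX.
have N0r : N != 0 by rewrite pnatr_eq0 -lt0n.
have EX (f : nat -> R) : f 0%N = f (2 ^ n)%N ->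
    mean (2 ^ n) f = (\sum_(t <- bits n) f (Xval t)) / N.
  by move=> h; rewrite mean_shift // sum_Xval.
have EY (f : nat -> R) : f 0%N = f (2 ^ n)%N ->
    mean (2 ^ n) f = (\sum_(t <- bits n) f (Yval t)) / N.
  by move=> h; rewrite mean_shift // sum_Yval.
have mean0 (f : nat -> R) : (forall a, (a <= 2 ^ n)%N -> f a = 0) -> mean (2 ^ n) f = 0.
  move=> h; rewrite /mean big1_seq ?mul0r // => a; rewrite mem_index_iota => /andP[_ /andP[_ ha]].
  exact: h.
pose w e := walk_mean theta e.
have rowE t : size t = n -> mean (2 ^ n) (D (Xval t)) = g t.
  move=> ht; have hX : (Xval t <= 2 ^ n)%N by rewrite ltnW // -ht Xval_lt.
  rewrite EY ?D0' ?DN' //.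
  rewrite (eq_big_seq (fun e => g t + walk theta 0 t e)); last first.
    by move=> e; rewrite mem_bits => /eqP he; exact: hD.
  by rewrite big_split /= walk_sum0 // addr0 sum_bits_cst -NE mulrAC divff // mul1r.
have colE e : size e = n -> mean (2 ^ n) (D ^~ (Yval e)) = (\sum_(t <- bits n) g t + w e) / N.
  move=> he; have hY : (Yval e <= 2 ^ n)%N by rewrite ltnW // -he Yval_lt.
  rewrite EX ?D0 ?DN //; congr (_ / _).
  rewrite (eq_big_seq (fun t => g t + walk theta 0 t e)); last first.
    by move=> t; rewrite mem_bits => /eqP ht; exact: hD.
  by rewrite big_split /= (sum_walk _ _ he).
have sum_w : \sum_(e <- bits n) w e = 0.
  rewrite (eq_big_seq (fun e => \sum_(t <- bits n) walk theta 0 t e)).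
    rewrite exchange_big big1_seq // => t /andP[_]; rewrite mem_bits => /eqP ht.
    exact: walk_sum0.
  by move=> e; rewrite mem_bits => /eqP he; rewrite (sum_walk _ _ he).
rewrite /interaction.
have -> : mean (2 ^ n) (fun a => mean (2 ^ n) (fun b => D a b ^+ 2)) =
    (\sum_(t <- bits n) g t ^+ 2) / N + cst_coef q n.
  rewrite EX; last first.
    by rewrite !mean0 // => b hb; rewrite ?D0 ?DN ?expr0n.
  transitivity ((\sum_(t <- bits n) (N * g t ^+ 2 + \sum_(e <- bits n) walk theta 0 t e ^+ 2) / N) / N).
    congr (_ / _); apply: eq_big_seq => t; rewrite mem_bits => /eqP ht.
    have hX : (Xval t <= 2 ^ n)%N by rewrite ltnW // -ht Xval_lt.
    rewrite EY ?D0' ?DN' //; congr (_ / _).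
    transitivity (\sum_(e <- bits n) (g t ^+ 2 + (2 * g t * walk theta 0 t e + walk theta 0 t e ^+ 2))).
      by apply: eq_big_seq => e; rewrite mem_bits => /eqP he; rewrite hD //; ring.
    by rewrite !big_split /= -[X in _ + (X + _)]mulr_sumr walk_sum0 // sum_bits_cst NE; ring.
  rewrite -mulr_suml big_split /= (walk_sqr (q := q)) // -mulr_sumr.
  have -> : 4 ^+ n = N ^+ 2 by rewrite NE exprAC; congr (_ ^+ _); ring.
  by field.
have -> : mean (2 ^ n) (fun a => mean (2 ^ n) (D a) ^+ 2) = (\sum_(t <- bits n) g t ^+ 2) / N.
  rewrite EX; last by rewrite !mean0 // => b hb; rewrite ?D0 ?DN.
  congr (_ / _); apply: eq_big_seq => t; rewrite mem_bits => /eqP ht.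
  by rewrite rowE.
have -> : mean (2 ^ n) (fun a => mean (2 ^ n) (D a)) = (\sum_(t <- bits n) g t) / N.
  rewrite EX; last by rewrite !mean0 // => b hb; rewrite ?D0 ?DN.
  congr (_ / _); apply: eq_big_seq => t; rewrite mem_bits => /eqP ht.
  by rewrite rowE.
have -> : mean (2 ^ n) (fun b => mean (2 ^ n) (D ^~ b) ^+ 2) =
    ((\sum_(t <- bits n) g t) / N) ^+ 2 + (\sum_(0 <= k < n) r k) / 64.
  rewrite EY; last by rewrite !mean0 // => b hb; rewrite ?D0' ?DN'.
  set G := \sum_(t <- bits n) g t.
  rewrite (eq_big_seq (fun e => (G ^+ 2 / N ^+ 2) + (2 * G / N ^+ 2 * w e + w e ^+ 2 / N ^+ 2))).
    rewrite !big_split /= -[X in _ + (X + _)]mulr_sumr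
      -[X in _ + (_ + X)]mulr_suml sum_w (walk_mean_sqr (r := r)) //.
    rewrite sum_bits_cst -NE.
    have -> : 8 ^+ n = N ^+ 3 by rewrite NE exprAC; congr (_ ^+ _); ring.
    by field.
  by move=> e; rewrite mem_bits => /eqP he; rewrite colE // -/G; field.
ring.
Qed.

(** The last summand is the rounding term. With N = 2^n the volume has coefficient - w N, and w^2
    N^2 (1/144 - (1/12 - 1/(12 N^2))^2) = w^2 / 144 (2 - 1/N^2). *)
Lemma grid_net_L2 n Q w theta g (q r : nat -> R) : grid_net n Q w theta g ->
  (forall k, \sum_(t <- bits k) \sum_(e <- bits k) theta t e ^+ 2 = 4 ^+ k * q k) ->
  (forall k, \sum_(e <- bits k) (\sum_(t <- bits k) theta t e) ^+ 2 = 8 ^+ k * r k) ->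
  (extr_discrepancy 2 (grid_points n Q) ^+ 2)%E =
  (cst_coef q n - (\sum_(0 <= k < n) r k) / 64 + w ^+ 2 / 144 * (2 - 1 / 4 ^+ n))%:E.
Proof.
move=> [hs hran hc hrw hw] hq hr.
pose D := grid_discr n Q w.
pose N : R := 2 ^+ n.
have N0r : N != 0 by rewrite expf_neq0 // pnatr_eq0.
have N0 : (0 < 2 ^ n)%N by rewrite expn_gt0.
have Nn : (2 ^ n)%:R = N by rewrite natrX.
have Ngt0 : 0 < N by rewrite exprn_gt0.
set P := grid_points n Q.
have szP : size P = size Q by rewrite size_map.
pose pt (j : option 'I_(size P)) : option (nat * nat) := omap (fun i : 'I__ => nth (0, 0)%N Q i) j.
have ptP (i : 'I_(size P)) : nth (0, 0)%N Q i \in Q by rewrite mem_nth // -szP.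
have nthE (i : 'I_(size P)) : tnth (in_tuple P) i =
    ((nth (0, 0)%N Q i).1%:R / N, (nth (0, 0)%N Q i).2%:R / N).
  by rewrite (tnth_nth (0, 0)) /= (nth_map (0, 0)%N) // -szP.
have absE j : abscissa j = grid_coord R (2 ^ n) (omap fst (pt j)).
  by case: j => //= i; rewrite nthE Nn.
have ordE j : ordinate j = grid_coord R (2 ^ n) (omap snd (pt j)).
  by case: j => //= i; rewrite nthE Nn.
have on1 j : ongrid (2 ^ n) (omap fst (pt j)).
  by case: j => //= i; have /andP[] := hran _ (ptP i).
have on2 j : ongrid (2 ^ n) (omap snd (pt j)).
  by case: j => //= i; have /andP[] := hran _ (ptP i).
rewrite warnock; last first.
  move=> p /mapP[q' /hran /andP[h1 h2] ->]; split; rewrite /= in_itv /=.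
    by apply/andP; split; [exact: divr_ge0 (ler0n _ _) (ltW Ngt0)|
      rewrite ler_pdivrMr // mul1r -/N -Nn ler_nat ltnW].
  by apply/andP; split; [exact: divr_ge0 (ler0n _ _) (ltW Ngt0)|
    rewrite ler_pdivrMr // mul1r -/N -Nn ler_nat ltnW].
congr EFin.
have <- : interaction (2 ^ n) D = cst_coef q n - (\sum_(0 <= k < n) r k) / 64.
  apply: (interaction_walk (theta := theta) (g := g)) => //.
  - move=> b; rewrite /D /grid_discr mulr0 !mul0r subr0 big1 // => -[]; by [].
  - move=> a; rewrite /D /grid_discr mulr0 !mul0r subr0 big1 // => -[] ? ?; by rewrite andbF.
  - move=> b hb; rewrite /D /grid_discr Nn -/N mulrAC mulfK //.
    rewrite -hrw // -sumrB big1_seq // => p /andP[_ /hran /andP[-> _]].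
    by rewrite subrr.
  - move=> a ha; rewrite /D /grid_discr Nn -/N mulfK //.
    rewrite -hc // -sumrB big1_seq // => p /andP[_ /hran /andP[_ ->]].
    by rewrite andbT subrr.
pose f (j : option 'I_(size P)) := feature R (2 ^ n) (omap fst (pt j)).
pose h (j : option 'I_(size P)) := feature R (2 ^ n) (omap snd (pt j)).
have DE : D = fun a b => \sum_j coef j * (f j a * h j b).
  apply/funext => a; apply/funext => b; rewrite /D /grid_discr big_option addrC; congr (_ + _).
    rewrite (big_nth (0, 0)%N) -szP big_mkord; apply: eq_bigr => i _.
    by rewrite /= mul1r /f /h /feature /= -mulnb natrM.
  by rewrite /= /f /h /feature /= Nn szP hs -/N; field.
rewrite DE interaction_covar //.
rewrite (big_option2 (G := fun j k => coef j * coef k *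
  (covar (2 ^ n) (f j) (f k) * covar (2 ^ n) (h j) (h k)))); last first.
  move=> j k jk; congr (_ * _); rewrite !absE !ordE !kerI_covar // /f /h.
  by case: j k jk => [j|] [k|] //=; rewrite ?addr0 // => -[].
congr (_ + _).
have c00 : covar (2 ^ n) (feature R (2 ^ n) None) (feature R (2 ^ n) None) = 12^-1 - (12 * N ^+ 2)^-1.
  have := kerI_covar R N0 (isT : ongrid (2 ^ n) None) (isT : ongrid (2 ^ n) None).
  by rewrite /= Nn => ->; rewrite addrK.
have -> : covar (2 ^ n) (f None) (f None) = 12^-1 - (12 * N ^+ 2)^-1 by exact: c00.
rewrite /= szP hs -/N.
have -> : 4 ^+ n = N ^+ 2 by rewrite /N exprAC; congr (_ ^+ _); ring.
by field.
Qed.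
End GridNet.

(** * The Lp bound *)

Section ExpBounds.
Variable R : realType.

(** This is z / p <= exp (z / p) raised to the power p. *)
Lemma powR_le_expR (p z : R) : 0 < p -> 0 <= z -> z `^ p <= p `^ p * expR z.
Proof.
move=> p0 z0; have -> : z = p * (z / p) by rewrite mulrC divfK // gt_eqF.
have zp0 : 0 <= z / p by rewrite divr_ge0 // ltW.
rewrite powRM //; last exact: ltW.
rewrite ler_wpM2l ?powR_ge0 // [p * _]mulrC expRM.
apply: ge0_ler_powR; rewrite ?nnegrE ?expR_ge0 //; first exact: ltW.
by apply: le_trans (expR_ge1Dx _); rewrite lerDr.
Qed.

(** By exp d <= 1 / (1 - d) the left side is at most 2 / (1 - c^2). *)
Lemma expR_sym_le (c : R) : `|c| <= 2^-1 -> expR c + expR (- c) <= 2 * (1 + 2 * c ^+ 2).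
Proof.
rewrite ler_norml => /andP[c1 c2].
have inv (d : R) : d < 1 -> expR d <= (1 - d)^-1.
  move=> d1; rewrite -[expR d]invrK -expRN lef_pV2 ?posrE ?expR_gt0 ?subr_gt0 //.
  by have := expR_ge1Dx (- d).
have h1 : expR c <= (1 - c)^-1 by apply: inv; lra.
have h2 : expR (- c) <= (1 + c)^-1 by rewrite -[c in leRHS]opprK; apply: inv; lra.
apply: le_trans (lerD h1 h2) _.
have n1 : 1 - c != 0 by rewrite gt_eqF //; lra.
have n2 : 1 + c != 0 by rewrite gt_eqF //; lra.
have -> : (1 - c)^-1 + (1 + c)^-1 = 2 / (1 - c ^+ 2).
  by field; rewrite n2 n1 /= (_ : 1 - c ^+ 2 = (1 - c) * (1 + c)) ?mulf_neq0 //; ring.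
have c3 : c ^+ 2 <= 4^-1 by nra.
rewrite ler_pdivrMr; last by lra.
have := sqr_ge0 c; set s := c ^+ 2 in c3 * => s0; nra.
Qed.

(** The shorter walk does not involve the head of e, so each digit contributes a factor exp c + exp
    (- c), where |c| <= |lam| / 2 because |theta| <= 2 and the weight lies in [0, 1]. *)
Lemma walk_exp (theta : seq bool -> seq bool -> R) (lam B : R) n t :
  `|lam| <= 1 -> (forall t e, `|theta t e| <= 2) -> 0 <= B <= 1 -> size t = n ->
  \sum_(e <- bits n) expR (lam * walk theta B t e) <= (2 * (1 + lam ^+ 2 / 2)) ^+ n.
Proof.
move=> hlam hth; elim: n t B => [|n IH] [|x t] B // /andP[B0 B1].
  by move=> _; rewrite big_seq1 /= mulr0 expR0 expr0.
case=> ht; rewrite big_bits /= exprSr.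
have hB : 0 <= (x%:R + B) / 2 <= 1 by case: x; rewrite /= ?mulr0n ?mulr1n; lra.
apply: le_trans (_ : (\sum_(e <- bits n) expR (lam * walk theta ((x%:R + B) / 2) t e)) *
   (2 * (1 + lam ^+ 2 / 2)) <= _); last first.
  rewrite ler_wpM2r //; last exact: IH.
  by have := sqr_ge0 lam; lra.
rewrite mulr_suml; apply: ler_sum => e _.
set u := walk _ _ _ _; set s := x%:R + B * sg R x.
have hs : 0 <= s <= 1 by rewrite /s /sg; case: x {hB s u} => /=; rewrite ?mulr0n ?mulr1n; lra.
pose c := lam * theta t e * s / 4.
have -> : lam * (u + sg R false * theta t e * s / 4) = lam * u + c by rewrite /c /sg; ring.
have -> : lam * (u + sg R true * theta t e * s / 4) = lam * u - c by rewrite /c /sg; ring.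
rewrite !expRD -mulrDr ler_wpM2l ?expR_ge0 //.
have hc : `|c| <= `|lam| / 2.
  have := hth t e; rewrite /c !normrM => hth1.
  rewrite (ger0_norm (_ : 0 <= 4^-1)) // (ger0_norm (_ : 0 <= s)); last by case/andP: hs.
  have := normr_ge0 lam; have := normr_ge0 (theta t e).
  move: hs hth1; set a := `|lam|; set b := `|theta t e| => /andP[hs0 hs1] hb b0 a0.
  have bs : b * s <= 2 by nra.
  have := ler_wpM2l a0 bs; lra.
have c2 : c ^+ 2 <= lam ^+ 2 / 4.
  rewrite -real_normK ?num_real // -[lam ^+ 2]real_normK ?num_real //.
  have := normr_ge0 c; have := normr_ge0 lam; nra.
apply: le_trans (expR_sym_le _) _; first by lra.
lra.
Qed.

Lemma pow_expR1 (n : nat) : (0 < n)%N -> (1 + (n%:R)^-1 / 2) ^+ n <= expR 1 :> R.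
Proof.
move=> n0; have nr : 0 < n%:R :> R by rewrite ltr0n.
have -> : expR 1 = expR n%:R^-1 ^+ n :> R by rewrite -expRM_natl mulfV // gt_eqF.
have : 0 < n%:R^-1 :> R by rewrite invr_gt0.
set v := _^-1 => v0.
apply: lerXn2r; rewrite ?nnegrE ?expR_ge0 //; first by lra.
by apply: le_trans (expR_ge1Dx _); lra.
Qed.

End ExpBounds.

Lemma Xval_surj n a : (a < 2 ^ n)%N -> exists2 t, t \in bits n & Xval t = a.
Proof.
elim: n a => [|n IH] a; first by rewrite expn0 ltnS leqn0 => /eqP ->; exists [::].
move=> ha; have [|t] := IH a./2; first by rewrite ltn_half_double -mul2n -expnS.
rewrite mem_bits => /eqP ht hX; exists (odd a :: t); first by rewrite mem_bits /= ht.
by rewrite /= hX mul2n odd_double_half.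
Qed.

Lemma Yval_surj n b : (b < 2 ^ n)%N -> exists2 e, e \in bits n & Yval e = b.
Proof.
elim: n b => [|n IH] b; first by rewrite expn0 ltnS leqn0 => /eqP ->; exists [::].
move=> hb; have [h|h] := ltnP b (2 ^ n)%N.
  have [e] := IH b h; rewrite mem_bits => /eqP he hY.
  by exists (false :: e); rewrite ?mem_bits /= ?he.
have [|e] := IH (b - 2 ^ n)%N; first by rewrite ltn_subLR // addnn -mul2n -expnS.
rewrite mem_bits => /eqP he hY; exists (true :: e); first by rewrite mem_bits /= he.
by rewrite /= he hY mul1n subnKC.
Qed.

Lemma indic_diff_le (R : realFieldType) (A B a a' b b' : bool) :
  (A -> a') -> (B -> b') -> (a -> a') -> (b -> b') ->
  (A && B)%:R - (a && b)%:R <= a'%:R - a%:R + (b'%:R - b%:R) :> R.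
Proof.
move=> h1 h2 h3 h4.
have := h1; have := h2; have := h3; have := h4 => {h1 h2 h3 h4}.
case: A; case: B; case: a; case: b; case: a'; case: b' => h1 h2 h3 h4;
  rewrite ?mulr0n ?mulr1n /=; try lra;
  by [have := h1 isT|have := h2 isT|have := h3 isT|have := h4 isT].
Qed.

(** * Rounding box corners to the grid *)

Section Rounding.
Variable R : realType.
Variables (n : nat) (Q : seq (nat * nat)) (w : R).
Variables (theta : seq bool -> seq bool -> R) (g : seq bool -> R).
Hypothesis netQ : grid_net n Q w theta g.

Let N : R := 2 ^+ n.
Let N0 : 0 < N. Proof. exact: exprn_gt0. Qed.
Let NE : (2 ^ n)%:R = N. Proof. exact: natrX. Qed.

Lemma net_weight_ge0 : 0 <= w.
Proof.
have := net_size netQ; rewrite -/N => h.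
by rewrite -(pmulr_lge0 _ N0) -h.
Qed.

(** Closed on both sides so that the last cell contains 1; a point on the grid may be assigned to
    either neighbouring cell. *)
Definition cell (a : nat) : set R := `[a%:R / N, a.+1%:R / N].

Lemma cell_exists (al : R) : 0 <= al <= 1 -> exists2 a, (a < 2 ^ n)%N & cell a al.
Proof.
move=> /andP[al0 al1].
have Nal0 : 0 <= N * al by rewrite mulr_ge0 // ltW.
have [h|h] := ltP (N * al) N.
  exists (Num.trunc (N * al)); first by rewrite -(ltr_nat R) NE (le_lt_trans _ h) // truncn_le.
  rewrite /cell /= in_itv /= ler_pdivrMr // ler_pdivlMr // [al * N]mulrC truncn_le.
  by rewrite Nal0 ltW // truncnS_gt.
have -> : al = 1.
  by apply/le_anti; rewrite al1 -(ler_pM2l N0) mulr1.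
have n0 : (0 < 2 ^ n)%N by rewrite expn_gt0.
exists (2 ^ n).-1; first by rewrite prednK.
rewrite /cell /= in_itv /= prednK // NE divff ?gt_eqF // lexx andbT.
by rewrite ler_pdivrMr // mul1r -NE ler_nat leq_pred.
Qed.

Definition local_discr (al be : R) : R :=
  \sum_(p <- grid_points R n Q) ((p.1 < al) && (p.2 < be))%R%:R
  - (size Q)%:R * (al * be).

(** Moving to the lower grid corner decreases the count by at most one column and one row, and the
    volume term by at most 2 w. Both changes lie in [0, 2 w], hence so does the absolute value of
    their difference. *)
Lemma local_discr_round al be a b : (a < 2 ^ n)%N -> (b < 2 ^ n)%N ->
  0 <= al <= 1 -> 0 <= be <= 1 -> cell a al -> cell b be ->
  `|local_discr al be - grid_discr n Q w a b| <= 2 * w.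
Proof.
move=> aN bN /andP[al0 al1] /andP[be0 be1].
rewrite /cell /= !in_itv /= => /andP[al2 al3] /andP[be2 be3].
have w0 := net_weight_ge0.
rewrite /local_discr /grid_discr big_map (net_size netQ) -/N.
have hlt (q k : nat) x : k%:R / N <= x -> x <= k.+1%:R / N ->
    ((q < k)%N ==> (q%:R / N < x)) && ((q%:R / N < x) ==> (q < k.+1)%N).
  move=> h1 h2; apply/andP; split; apply/implyP => h.
    by apply: lt_le_trans h1; rewrite ltr_pM2r ?invr_gt0 // ltr_nat.
  by have := lt_le_trans h h2; rewrite ltr_pM2r ?invr_gt0 // ltr_nat.
set A' := \sum_(q <- Q) ((q.1 < a) && _)%N%:R.
set A := \sum_(q <- Q) _.
have hA : 0 <= A - A' <= 2 * w.
  rewrite -sumrB; apply/andP; split.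
    apply: sumr_ge0 => q _.
    have /andP[/implyP h1 _] := hlt q.1 a al al2 al3.
    have /andP[/implyP h2 _] := hlt q.2 b be be2 be3.
    rewrite subr_ge0 ler_nat; move: h1 h2.
    case: (q.1 < a)%N; case: (q.2 < b)%N => h1 h2 //=.
    by rewrite (h1 isT) (h2 isT).
  apply: (@le_trans _ _ (\sum_(q <- Q) ((q.1 < a.+1)%N%:R - (q.1 < a)%N%:R
      + ((q.2 < b.+1)%N%:R - (q.2 < b)%N%:R)))).
    apply: ler_sum => q _.
    have /andP[_ /implyP h1] := hlt q.1 a al al2 al3.
    have /andP[_ /implyP h2] := hlt q.2 b be be2 be3.
    by apply: indic_diff_le => //; move/ltnW.
  rewrite big_split !sumrB /= !(net_cols netQ) ?(ltnW aN) // !(net_rows netQ) ?(ltnW bN) //.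
  by rewrite -!natr1; lra.
pose x := al - a%:R / N; pose y := be - b%:R / N.
have x0 : 0 <= x by rewrite /x; lra.
have y0 : 0 <= y by rewrite /y; lra.
have x1 : N * x <= 1.
  by rewrite /x mulrBr mulrCA divff ?gt_eqF // mulr1 lerBlDr addrC natr1 mulrC -ler_pdivlMr.
have y1 : N * y <= 1.
  by rewrite /y mulrBr mulrCA divff ?gt_eqF // mulr1 lerBlDr addrC natr1 mulrC -ler_pdivlMr.
have E : w * N * (al * be) - w * a%:R * b%:R / N = w * (N * x * be + a%:R / N * (N * y)).
  by rewrite /x /y; field; rewrite gt_eqF.
have a0 : 0 <= a%:R / N by rewrite divr_ge0 // ltW.
have a1 : a%:R / N <= 1 by apply: le_trans al2 al1.
have h : 0 <= w * N * (al * be) - w * a%:R * b%:R / N <= 2 * w.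
  rewrite E; have Nx : 0 <= N * x by rewrite mulr_ge0 // ltW.
  have Ny : 0 <= N * y by rewrite mulr_ge0 // ltW.
  have p1 : 0 <= N * x * be <= 1 by apply/andP; split; [exact: mulr_ge0|exact: mulr_ile1].
  have p2 : 0 <= a%:R / N * (N * y) <= 1 by apply/andP; split; [exact: mulr_ge0|exact: mulr_ile1].
  move: p1 p2 => /andP[? ?] /andP[? ?].
  apply/andP; split; first by apply: mulr_ge0 => //; exact: addr_ge0.
  by rewrite mulrC ler_wpM2r //; lra.
rewrite ler_norml; move: h hA => /andP[? ?] /andP[? ?]; apply/andP; split; lra.
Qed.

Lemma box_discr_corners (x y : R * R) : le_pt x y ->
  box_discr (grid_points R n Q) x y =
  local_discr y.1 y.2 - local_discr x.1 y.2 - local_discr y.1 x.2 + local_discr x.1 x.2.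
Proof.
move=> xy; rewrite box_discrE // size_map /local_discr.
set P := grid_points _ _ _.
have rampE z a b : a <= b -> ramp z a b = (z < b)%R%:R - (z < a)%R%:R :> R.
  rewrite /ramp; have [za|az] := ltP z a; rewrite /= ?mul0r ?mul1r ?subr0 ?mulr0n //.
  by move=> ab; rewrite (lt_le_trans za ab) /= subrr.
have -> : \sum_(p <- P) ramp p.1 x.1 y.1 * ramp p.2 x.2 y.2 =
    \sum_(p <- P) ((p.1 < y.1) && (p.2 < y.2))%R%:R - \sum_(p <- P) ((p.1 < x.1) && (p.2 < y.2))%R%:R
    - \sum_(p <- P) ((p.1 < y.1) && (p.2 < x.2))%R%:R + \sum_(p <- P) ((p.1 < x.1) && (p.2 < x.2))%R%:R.
  rewrite -!sumrB -big_split; apply: eq_bigr => p _.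
  case: xy => h1 h2; rewrite !rampE // /= -!mulnb !natrM; ring.
ring.
Qed.

End Rounding.

(** * Domination by a step function and the Lp estimate *)

Section LpBound.
Variable R : realType.
Notation mu := (@lebesgue_measure R).
Notation I01 := (`[0%R : R, 1%R : R]%classic).

Definition length01 (A : set R) : R := fine (mu (A `&` I01)).

Lemma mu_I01 : mu I01 = 1%E.
Proof. by rewrite lebesgue_measure_itv /= lte_fin ltr01 -EFinB subr0. Qed.

Lemma length01E (A : set R) : measurable A -> mu (A `&` I01) = (length01 A)%:E.
Proof.
move=> mA; rewrite fineK // ge0_fin_numE //.
apply: (@le_lt_trans _ _ 1%E); last exact: ltry.
rewrite -mu_I01; apply: le_measure; rewrite ?inE //.
exact: measurableI.
Qed.

(** The flag c selects the corner constrained by the cell: the upper corner y if true, the lower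
    corner x otherwise. *)
Lemma kern_indic (c : bool) (A : set R) : measurable A ->
  kern (fun=> I01) (fun x y => \1_A (if c then y else x) : R)
    (fun y => if c then \1_A y else length01 A) (length01 A).
Proof.
move=> mA.
have icst (r : R) : mu.-integrable I01 (fun=> r%:E) /\ (\int[mu]_(x in I01) r%:E = r%:E)%E.
  split; last by rewrite integral_cst //= mu_I01 mule1.
  apply/integrableP; split; first exact: measurable_cst.
  by rewrite integral_cst //= mu_I01 mule1 ltry.
have iind : mu.-integrable I01 (fun x => (\1_A x)%:E) /\
    (\int[mu]_(x in I01) (\1_A x)%:E = (length01 A)%:E)%E.
  have E : (\int[mu]_(x in I01) (\1_A x)%:E = (length01 A)%:E)%E.
    by transitivity (mu (A `&` I01)); [exact: integral_indic|exact: length01E].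
  split=> //; apply/integrableP; split.
    by apply/measurable_EFinP; exact: measurable_indic.
  under eq_integral do rewrite gee0_abs ?lee_fin //.
  by rewrite [X in (X < _)%E]E ltry.
by case: c; split=> [y _|]; [exact: icst|exact: iind|exact: iind|exact: icst].
Qed.

Lemma length01_ge0 (A : set R) : 0 <= length01 A.
Proof. by rewrite fine_ge0. Qed.

Lemma length01_cell n a : length01 (@cell R n a) <= (2 ^+ n)^-1.
Proof.
have mC : measurable (@cell R n a) by exact: measurable_itv.
rewrite -lee_fin -length01E //.
have -> : ((2 ^+ n)^-1)%:E = mu (@cell R n a).
  rewrite lebesgue_measure_itv /= lte_fin ltr_pM2r ?invr_gt0 ?exprn_gt0 // ltr_nat ltnSn.
  by rewrite -EFinB -mulrBl -natrB // subSnn mul1r.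
apply: le_measure; rewrite ?inE //.
exact: measurableI.
Qed.

Lemma ler_sum_mem (T : eqType) (s : seq T) (F : T -> R) x :
  x \in s -> (forall y, 0 <= F y) -> F x <= \sum_(y <- s) F y.
Proof.
by move=> xs F0; rewrite (big_rem x) //= lerDl; apply: sumr_ge0.
Qed.

Section Net.
Variables (n : nat) (Q : seq (nat * nat)) (w : R).
Variables (theta : seq bool -> seq bool -> R) (g : seq bool -> R).
Hypothesis n0 : (0 < n)%N.
Hypothesis netQ : grid_net n Q w theta g.
Hypothesis theta2 : forall t e, `|theta t e| <= 2.

Let P := grid_points R n Q.
Let W t e := walk theta 0 t e.
(** With lam^2 = 1 / n the factor (1 + lam^2 / 2)^n from [walk_exp] stays below e: sqrt n is the
    scale of the walk. *)
Let lam : R := (Num.sqrt n%:R)^-1.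

Let sn0 : 0 < Num.sqrt n%:R :> R.
Proof. by rewrite sqrtr_gt0 ltr0n. Qed.

Let lam0 : 0 < lam. Proof. by rewrite invr_gt0. Qed.

Let lam1 : lam <= 1.
Proof.
rewrite invf_le1 // -[leLHS]sqrtr1.
by rewrite ler_wsqrtr // ler1n.
Qed.

Let lam2 : lam ^+ 2 = n%:R^-1.
Proof. by rewrite exprVn sqr_sqrtr // ler0n. Qed.

(** Each of the four corner roundings costs 2 w. *)
Lemma box_discr_le (x y : R * R) (t1 t2 e1 e2 : seq bool) : le_pt x y ->
  unit_square x -> unit_square y ->
  t1 \in bits n -> t2 \in bits n -> e1 \in bits n -> e2 \in bits n ->
  @cell R n (Xval t1) x.1 -> @cell R n (Xval t2) y.1 ->
  @cell R n (Yval e1) x.2 -> @cell R n (Yval e2) y.2 ->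
  `|box_discr P x y| <= 8 * w + (`|W t2 e2| + `|W t1 e2| + `|W t2 e1| + `|W t1 e1|).
Proof.
rewrite !mem_bits => xy [+ +] [+ +] /eqP st1 /eqP st2 /eqP se1 /eqP se2 c1 c2 c3 c4.
rewrite /= !in_itv /= => hx1 hx2 hy1 hy2.
have Xlt t : size t = n -> (Xval t < 2 ^ n)%N by move=> <-; exact: Xval_lt.
have Ylt t : size t = n -> (Yval t < 2 ^ n)%N by move=> <-; exact: Yval_lt.
rewrite /P (box_discr_corners _ _ xy).
have r22 := local_discr_round netQ (Xlt _ st2) (Ylt _ se2) hy1 hy2 c2 c4.
have r12 := local_discr_round netQ (Xlt _ st1) (Ylt _ se2) hx1 hy2 c1 c4.
have r21 := local_discr_round netQ (Xlt _ st2) (Ylt _ se1) hy1 hx2 c2 c3.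
have r11 := local_discr_round netQ (Xlt _ st1) (Ylt _ se1) hx1 hx2 c1 c3.
have E t e : size t = n -> size e = n -> grid_discr n Q w (Xval t) (Yval e) = g t + W t e.
  exact: net_walk.
rewrite !E // in r22 r12 r21 r11.
move: r22 r12 r21 r11; rewrite !ler_norml => /andP[? ?] /andP[? ?] /andP[? ?] /andP[? ?].
have n22 := ler_norm (W t2 e2); have n22' := ler_norm (- W t2 e2); rewrite normrN in n22'.
have n12 := ler_norm (W t1 e2); have n12' := ler_norm (- W t1 e2); rewrite normrN in n12'.
have n21 := ler_norm (W t2 e1); have n21' := ler_norm (- W t2 e1); rewrite normrN in n21'.
have n11 := ler_norm (W t1 e1); have n11' := ler_norm (- W t1 e1); rewrite normrN in n11'.
apply/andP; split; lra.
Qed.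

(** A majorant of exp (lam |W|) made of two terms to which [walk_exp] applies directly. *)
Let h t e := expR (lam * W t e) + expR (- (lam * W t e)).

Let h_ge0 t e : 0 <= h t e. Proof. by rewrite addr_ge0 ?expR_ge0. Qed.

Let sum_h : \sum_(t <- bits n) \sum_(e <- bits n) h t e <= 2 * expR 1 * (2 ^+ n) ^+ 2.
Proof.
have bnd l t : `|l| = lam -> size t = n -> \sum_(e <- bits n) expR (l * W t e) <= 2 ^+ n * expR 1.
  move=> hl ht; apply: le_trans (walk_exp _ theta2 _ ht) _.
  - by rewrite hl.
  - by rewrite lexx ler01.
  - rewrite -real_normK ?num_real // hl lam2 exprMn ler_wpM2l ?exprn_ge0 //.
    exact: pow_expR1.
apply: (@le_trans _ _ (\sum_(t <- bits n) 2 * expR 1 * 2 ^+ n)).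
  rewrite big_seq [leRHS]big_seq; apply: ler_sum => t; rewrite mem_bits => /eqP ht.
  rewrite /h big_split /=.
  have b1 := bnd lam t (gtr0_norm lam0) ht.
  have := bnd (- lam) t _ ht; rewrite normrN => /(_ (gtr0_norm lam0)) b2.
  under [X in _ + X]eq_bigr do rewrite -mulNr.
  lra.
by rewrite sum_bits_cst; nra.
Qed.

(** After trading the power for an exponential, the exponent is 2 w plus a mean over the corners. A
    mean is at most the largest entry, so its exponential is at most the sum of the four [h]; each
    term then involves a single corner and no joint moment is needed. *)
Let box_powR (p : R) (x y : R * R) (t1 t2 e1 e2 : seq bool) : 1 < p -> le_pt x y ->
  unit_square x -> unit_square y ->
  t1 \in bits n -> t2 \in bits n -> e1 \in bits n -> e2 \in bits n ->
  cell n (Xval t1) x.1 -> cell n (Xval t2) y.1 ->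
  cell n (Yval e1) x.2 -> cell n (Yval e2) y.2 ->
  `|box_discr P x y| `^ p <= Num.sqrt n%:R `^ p * (4 `^ p * p `^ p * expR (2 * w)) *
    (h t2 e2 + h t1 e2 + h t2 e1 + h t1 e1).
Proof.
move=> p1 xy xU yU m1 m2 m3 m4 c1 c2 c3 c4.
have := box_discr_le xy xU yU m1 m2 m3 m4 c1 c2 c3 c4.
set b := `|box_discr P x y| => hb.
have w0 := net_weight_ge0 netQ.
have p0 : 0 < p by lra.
pose X t e := lam * `|W t e|.
have X0 t e : 0 <= X t e by rewrite mulr_ge0 // ltW.
have Xh t e : expR (X t e) <= h t e.
  rewrite /X /h -mulrN; have a1 := expR_ge0 (lam * W t e).
  have a2 := expR_ge0 (lam * - W t e).
  by case: (ger0P (W t e)) => _; lra.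
pose S := X t2 e2 + X t1 e2 + X t2 e1 + X t1 e1.
have S0 : 0 <= S by rewrite !addr_ge0.
pose z := 2 * w + S / 4.
have z0 : 0 <= z by rewrite /z; lra.
have bz : b <= Num.sqrt n%:R * (4 * z).
  rewrite mulrC -ler_pdivrMr // -/lam mulrC.
  apply: le_trans (ler_wpM2l (ltW lam0) hb) _.
  rewrite mulrDr; have : lam * (8 * w) <= 8 * w by rewrite ler_piMl // mulr_ge0.
  have -> : lam * (`|W t2 e2| + `|W t1 e2| + `|W t2 e1| + `|W t1 e1|) = S.
    by rewrite /S /X; ring.
  rewrite /z; lra.
apply: (@le_trans _ _ ((Num.sqrt n%:R * (4 * z)) `^ p)).
  apply: ge0_ler_powR => //; first exact: ltW.
  - by rewrite nnegrE normr_ge0.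
  - by rewrite nnegrE !mulr_ge0 ?sqrtr_ge0.
rewrite powRM ?sqrtr_ge0 //; last by rewrite mulr_ge0.
rewrite -mulrA ler_wpM2l ?powR_ge0 // powRM // -!mulrA ler_wpM2l ?powR_ge0 //.
apply: le_trans (powR_le_expR p0 z0) _; rewrite ler_wpM2l ?powR_ge0 //.
rewrite /z expRD ler_wpM2l ?expR_ge0 //.
have h1 := Xh t2 e2; have h2 := Xh t1 e2; have h3 := Xh t2 e1; have h4 := Xh t1 e1.
have g1 := h_ge0 t2 e2; have g2 := h_ge0 t1 e2; have g3 := h_ge0 t2 e1; have g4 := h_ge0 t1 e1.
have big u : S / 4 <= u -> expR (S / 4) <= expR u by rewrite ler_expR.
have [q1|q1] := lerP (S / 4) (X t2 e2); first by have := big _ q1; lra.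
have [q2|q2] := lerP (S / 4) (X t1 e2); first by have := big _ q2; lra.
have [q3|q3] := lerP (S / 4) (X t2 e1); first by have := big _ q3; lra.
have [q4|q4] := lerP (S / 4) (X t1 e1); first by have := big _ q4; lra.
by exfalso; rewrite /S in q1 q2 q3 q4; lra.
Qed.

(** The power of the discrepancy is dominated by a step function on cells, integrated with x running
    over the whole square so that it factors into cell lengths of at most 2^-n. The constant 8 e
    counts four corners, two exponentials in [h], and a factor e for each exponential moment. *)
Lemma grid_net_Lp (p : R) : 1 < p ->
  (extr_discrepancy p P <=
   ((8 * expR 1 * (4 `^ p * p `^ p * expR (2 * w))) `^ p^-1 * Num.sqrt n%:R)%:E)%E.
Proof.
move=> p1; have p0 : 0 < p by lra.
pose K := 4 `^ p * p `^ p * expR (2 * w).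
have K0 : 0 <= K by rewrite !mulr_ge0 ?powR_ge0 ?expR_ge0.
pose KK := Num.sqrt n%:R `^ p * K.
have KK0 : 0 <= KK by rewrite mulr_ge0 ?powR_ge0.
pose cs := [:: (true, true); (false, true); (true, false); (false, false)].
pose s := [seq (c, te) | c <- cs, te <- [seq (t, e) | t <- bits n, e <- bits n]].
pose cf (j : (bool * bool) * (seq bool * seq bool)) := KK * h j.2.1 j.2.2.
pose u (j : (bool * bool) * (seq bool * seq bool)) (x y : R) : R :=
  \1_(cell n (Xval j.2.1)) (if j.1.1 then y else x).
pose u' (j : (bool * bool) * (seq bool * seq bool)) (x y : R) : R :=
  \1_(cell n (Yval j.2.2)) (if j.1.2 then y else x).
have sumE (G : (bool * bool) * (seq bool * seq bool) -> R) : \sum_(j <- s) G j =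
    let S c := \sum_(te <- [seq (t, e) | t <- bits n, e <- bits n]) G (c, te) in
    S (true, true) + (S (false, true) + (S (true, false) + S (false, false))).
  by rewrite /s big_allpairs /cs !big_cons big_nil /= addr0.
pose F (x y : R * R) := \sum_(j <- s) cf j * (u j x.1 y.1 * u' j x.2 y.2).
have cf0 j : 0 <= cf j by exact: mulr_ge0.
have u0 j x y : 0 <= u j x y by rewrite /u indicE ler0n.
have u'0 j x y : 0 <= u' j x y by rewrite /u' indicE ler0n.
have term0 j (x y : R * R) : 0 <= cf j * (u j x.1 y.1 * u' j x.2 y.2).
  exact: mulr_ge0 (cf0 j) (mulr_ge0 (u0 j _ _) (u'0 j _ _)).
have F0 x y : 0 <= F x y by apply: sumr_ge0 => j _; exact: term0.
have boxF x y : unit_square x -> unit_square y -> le_pt x y -> `|box_discr P x y| `^ p <= F x y.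
  move=> xU yU xy; case: (xU) (yU) => [+ +] [+ +].
  rewrite /= !in_itv /= => hx1 hx2 hy1 hy2.
  have exX (r : R) : 0 <= r <= 1 -> exists2 t, t \in bits n & cell n (Xval t) r.
    move=> /(cell_exists n)[a /Xval_surj[t tb ta] ca]; exists t => //.
    by rewrite ta.
  have exY (r : R) : 0 <= r <= 1 -> exists2 t, t \in bits n & cell n (Yval t) r.
    move=> /(cell_exists n)[a /Yval_surj[t tb ta] ca]; exists t => //.
    by rewrite ta.
  have [t1 m1 c1] := exX _ hx1; have [t2 m2 c2] := exX _ hy1.
  have [e1 m3 c3] := exY _ hx2; have [e2 m4 c4] := exY _ hy2.
  apply: le_trans (box_powR p1 xy xU yU m1 m2 m3 m4 c1 c2 c3 c4) _.
  have corner (d1 d2 : bool) t e : t \in bits n -> e \in bits n ->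
      cell n (Xval t) (if d1 then y.1 else x.1) -> cell n (Yval e) (if d2 then y.2 else x.2) ->
      KK * h t e <= \sum_(te <- [seq (t, e) | t <- bits n, e <- bits n])
        cf ((d1, d2), te) * (u ((d1, d2), te) x.1 y.1 * u' ((d1, d2), te) x.2 y.2).
    move=> tb eb ct ce.
    have mem : (t, e) \in [seq (t, e) | t <- bits n, e <- bits n].
      by apply/allpairsP; exists (t, e).
    apply: le_trans (ler_sum_mem mem _); last by move=> te; exact: term0.
    by rewrite /cf /u /u' /= !indicE !mem_set //= !mulr1.
  have -> a b c d : KK * (a + b + c + d) = KK * a + (KK * b + (KK * c + KK * d)) by ring.
  rewrite /F sumE.
  by repeat apply: lerD; apply: corner.
have mcell k : measurable (cell n k : set R) by exact: measurable_itv.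
have intF := kern_tensor (S := fun=> I01) s cf (fun=> @measurable_itv R `[0, 1])
  (fun j => kern_indic j.1.1 (mcell (Xval j.2.1)))
  (fun j => kern_indic j.1.2 (mcell (Yval j.2.2))).
pose len k := length01 (cell n k).
have len0 k : 0 <= len k by exact: length01_ge0.
have sumF : \sum_(j <- s) cf j * (len (Xval j.2.1) * len (Yval j.2.2)) <=
    Num.sqrt n%:R `^ p * (8 * expR 1 * K).
  have one c : \sum_(te <- [seq (t, e) | t <- bits n, e <- bits n])
      cf (c, te) * (len (Xval te.1) * len (Yval te.2)) <= KK * (2 * expR 1).
    rewrite big_allpairs /=.
    apply: (@le_trans _ _ (KK / (2 ^+ n) ^+ 2 * \sum_(t <- bits n) \sum_(e <- bits n) h t e)).
      rewrite mulr_sumr; apply: ler_sum => t _; rewrite mulr_sumr; apply: ler_sum => e _.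
      have -> : KK / (2 ^+ n) ^+ 2 * h t e = KK * h t e * ((2 ^+ n)^-1 * (2 ^+ n)^-1).
        by rewrite expr2 invfM; ring.
      apply: ler_wpM2l; first exact: mulr_ge0.
      by apply: ler_pM => //; exact: length01_cell.
    apply: le_trans (ler_wpM2l _ sum_h) _; first by rewrite divr_ge0 ?exprn_ge0.
    by rewrite le_eqVlt; apply/orP; left; apply/eqP; field; rewrite expf_neq0.
  rewrite sumE.
  apply: (@le_trans _ _ (KK * (2 * expR 1) + (KK * (2 * expR 1) + (KK * (2 * expR 1) + KK * (2 * expR 1))))).
    by repeat apply: lerD; apply: one.
  by rewrite /KK le_eqVlt; apply/orP; left; apply/eqP; ring.
rewrite extr_discrepancyE.
have C0 : 0 <= 8 * expR 1 * K by rewrite mulr_ge0 // mulr_ge0 // expR_ge0.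
have -> : (8 * expR 1 * (4 `^ p * p `^ p * expR (2 * w))) `^ p^-1 * Num.sqrt n%:R =
    (Num.sqrt n%:R `^ p * (8 * expR 1 * K)) `^ p^-1.
  rewrite (powRM _ (powR_ge0 _ _) C0).
  by rewrite -powRrM divff ?gt_eqF // powRr1 ?sqrtr_ge0 // mulrC.
rewrite -poweR_EFin.
apply: gt0_ler_poweR.
- by rewrite invr_ge0 ltW.
- rewrite in_itv /= leey andbT; apply: integral_ge0 => y _; apply: integral_ge0 => x _.
  by rewrite lee_fin powR_ge0.
- rewrite in_itv /= leey andbT lee_fin mulr_ge0 // powR_ge0.
apply: (@le_trans _ _ (\int[lambda2 R]_(y in @unit_square R)
    \int[lambda2 R]_(x in @unit_square R) (F x y)%:E)%E); last first.
  by rewrite /unit_square intF lee_fin.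
apply: ge0_le_integral_subset => //.
- by move=> y _; apply: integral_ge0 => x _; rewrite lee_fin powR_ge0.
- by move=> y _; apply: integral_ge0 => x _; rewrite lee_fin.
move=> y yU; rewrite -le_pt_domain //.
apply: ge0_le_integral_subset.
- by move=> x _; rewrite lee_fin powR_ge0.
- by move=> x _; rewrite lee_fin.
- exact: subIsetl.
- by move=> x [xU xy]; rewrite lee_fin; exact: boxF.
Qed.
End Net.
End LpBound.

(** * The nets of the paper *)

Section Instances.
Variable R : realType.
Implicit Types (psi : seq bool -> bool) (t u v : seq bool).

Definition scrambled_grid psi n : seq (nat * nat) :=
  [seq (Xval u, Yval (scramble psi u)) | u <- bits n].

Lemma grid_net_scramble psi n :
  grid_net n (scrambled_grid psi n) (1 : R) (net_theta R psi) (net_drift psi 0).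
Proof.
split.
- by rewrite size_map size_bits natrX mul1r.
- move=> q /mapP[u]; rewrite mem_bits => /eqP <- ->.
  by rewrite Xval_lt /= -(size_scramble psi u) Yval_lt.
- move=> a ha; rewrite big_map mul1r /=.
  by rewrite (sum_Xval n (fun s => (s < a)%N%:R)) sum_ltn.
- move=> b hb; rewrite big_map mul1r /=.
  rewrite (sum_scramble psi n (fun v => (Yval v < b)%N%:R)).
  by rewrite (sum_Yval n (fun s => (s < b)%N%:R)) sum_ltn.
- move=> t e ht he; rewrite big_map /= mul1r.
  have := net_discr_walk psi (0 : R) ht he; rewrite mul0r addr0 => <-.
  by [].
Qed.

Lemma walk_add (theta1 theta2 : seq bool -> seq bool -> R) B t e :
  walk (fun t e => theta1 t e + theta2 t e) B t e = walk theta1 B t e + walk theta2 B t e.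
Proof.
elim: t e B => [|x t IH] [|z e] B //=; rewrite ?addr0 // IH; ring.
Qed.

Lemma grid_net_cat n Q1 Q2 (w1 w2 : R) theta1 theta2 g1 g2 :
  grid_net n Q1 w1 theta1 g1 -> grid_net n Q2 w2 theta2 g2 ->
  grid_net n (Q1 ++ Q2) (w1 + w2) (fun t e => theta1 t e + theta2 t e) (fun t => g1 t + g2 t).
Proof.
move=> N1 N2; split.
- by rewrite size_cat natrD (net_size N1) (net_size N2) mulrDl.
- by move=> q; rewrite mem_cat => /orP[/(net_range N1)|/(net_range N2)].
- by move=> a ha; rewrite big_cat /= (net_cols N1) // (net_cols N2) // mulrDl.
- by move=> b hb; rewrite big_cat /= (net_rows N1) // (net_rows N2) // mulrDl.
- move=> t e ht he; have h1 := net_walk N1 ht he; have h2 := net_walk N2 ht he.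
  rewrite big_cat /= walk_add addrACA -h1 -h2; ring.
Qed.

Lemma net_theta_norm psi t e : `|net_theta R psi t e| = 1.
Proof.
by rewrite /net_theta normrM /cmp /sg; case: ifP => _; case: (psi t); rewrite ?normrN !normr1 mul1r.
Qed.

Lemma sym_theta_norm psi t e : `|sym_theta R psi t e| <= 2.
Proof.
by apply: le_trans (ler_normD _ _) _; rewrite !net_theta_norm.
Qed.

Lemma perm_extr_discrepancy (p : R) P P' :
  perm_eq P P' -> extr_discrepancy p P = extr_discrepancy p P'.
Proof.
move=> PP'; have E : box_discr P = box_discr P'.
  apply/funext => x; apply/funext => y; rewrite /box_discr /counting_fun.
  by rewrite (perm_size PP') (permP PP' (mem (box x y))).
by rewrite /extr_discrepancy E.
Qed.

Lemma sum_digits_rev m t : size t = m ->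
  \sum_(1 <= k < m.+1) (digit t (m.+1 - k))%:R / 2 ^+ k = (Xval t)%:R / 2 ^+ m :> R.
Proof.
elim: m t => [|m IH] [|x t] // h.
  by rewrite big_geq // mul0r.
case: h => h; rewrite big_nat_recr //= subSnn natrD natrM.
rewrite (eq_big_nat _ _ (F2 := fun k => (digit t (m.+1 - k))%:R / 2 ^+ k)).
  rewrite IH // exprS /digit /=; field.
  by rewrite expf_neq0.
by move=> k /andP[k1 km]; rewrite /digit (subSn (ltnW km)) //= -(prednK (n := m.+1 - k)) // subn_gt0.
Qed.

Lemma sum_digits v : \sum_(1 <= k < (size v).+1) (nth false v k.-1)%:R / 2 ^+ k =
  (Yval v)%:R / 2 ^+ size v :> R.
Proof.
elim: v => [|x v IH]; first by rewrite big_geq // mul0r.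
rewrite big_add1 /= big_nat_recl //=.
have -> : \sum_(0 <= i < size v) (nth false v i)%:R / 2 ^+ i.+2 =
    (\sum_(1 <= k < (size v).+1) (nth false v k.-1)%:R / 2 ^+ k) / 2 :> R.
  rewrite big_add1 /= mulr_suml; apply: eq_bigr => i _.
  by rewrite [2 ^+ i.+2]exprSr invfM mulrA.
rewrite IH natrD natrM natrX [2 ^+ (size v).+1]exprS; field.
by rewrite expf_neq0.
Qed.

Lemma nth_scramble psi t i : (i < size t)%N ->
  nth false (scramble psi t) i = nth false t i (+) psi (drop i.+1 t).
Proof.
elim: t i => //= x t IH [|i] h; first by rewrite drop0.
by rewrite /= IH.
Qed.

(** Tuples and [bits m] enumerate the same digit vectors in possibly different orders, and the
    discrepancy sees only the multiset. *)
Lemma perm_net m psi (b : seq bool -> nat -> bool) :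
  (forall t, size t = m -> forall k, (0 < k <= m)%N -> b t k = nth false (scramble psi t) k.-1) ->
  perm_eq [seq digital_point R m t (b t) | t : m.-tuple bool]
    (grid_points R m (scrambled_grid psi m)).
Proof.
move=> hb; rewrite /grid_points /scrambled_grid -map_comp.
have pe : perm_eq (map val (enum {: m.-tuple bool})) (bits m).
  apply: uniq_perm; [by rewrite map_inj_uniq ?enum_uniq //; exact: val_inj|exact: uniq_bits|].
  move=> t; rewrite mem_bits; apply/mapP/eqP => [[u _ ->]|h]; first exact: size_tuple.
  by exists (Tuple (introT eqP h)); rewrite ?mem_enum.
apply: perm_trans (perm_map _ pe); rewrite -map_comp.
suff -> : [seq digital_point R m t (b t) | t : m.-tuple bool] =
  [seq (((fun q : nat * nat => (q.1%:R / 2 ^+ m, q.2%:R / 2 ^+ m)) \o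
    (fun u => (Xval u, Yval (scramble psi u)))) \o val) i | i <- enum {: m.-tuple bool}] by [].
apply: eq_map => t /=; have st := size_tuple t.
rewrite /digital_point sum_digits_rev //; congr pair.
have := sum_digits (scramble psi t); rewrite size_scramble st => <-.
by apply: eq_big_nat => k hk; rewrite (hb _ st).
Qed.

Lemma parityE t k : parity (drop k t) =
  \big[addb/false]_(k.+1 <= j < (size t).+1) digit t j.
Proof.
have -> s : parity s = \big[addb/false]_(x <- s) x.
  by elim: s => [|x s IH]; rewrite ?big_nil // big_cons -IH.
rewrite (big_nth false) big_add1 /= -[k in RHS]add0n big_addn size_drop.
by apply: eq_bigr => i _; rewrite nth_drop /digit /= addnC.
Qed.

Section NetA.
Variables (m : nat) (a : m.-1.-tuple bool) (sigma : m.-tuple bool).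
Hypothesis m0 : (0 < m)%N.

Definition flip_a n := digit a (m - n).
Definition shift_a n := digit sigma (m - n).

(** Digit k is scrambled by the tail [drop k t], which has size m - k and ends in t_m. For k = m the
    tail is empty and [last] returns its default 0, which leaves t_m + sigma_m. *)
Lemma perm_net_a : perm_eq (net_a R a sigma)
  (grid_points R m (scrambled_grid (psi_a flip_a shift_a) m)).
Proof.
apply: (@perm_net _ _ (fun t k =>
     if (k < m)%N then digit t k (+) (digit a k && digit t m) (+) digit sigma k
     else digit t m (+) digit sigma m)) => t st k /andP[k0 km].
rewrite nth_scramble ?prednK ?st // /psi_a /flip_a /shift_a size_drop st subKn //.
have [h|h] := ltnP k m.
  rewrite -addbA; congr (_ (+) ((_ && _) (+) _)).
  rewrite -nth_last size_drop nth_drop st /digit; congr (nth _ _ _).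
  by rewrite -subn1; lia.
have -> : k = m by apply/eqP; rewrite eqn_leq km.
by rewrite drop_oversize ?st // andbF.
Qed.
End NetA.
End Instances.

Section Nets.
Variable R : realType.

Lemma perm_net_flip m (a : m.-1.-tuple bool) (sigma : m.-tuple bool) : (0 < m)%N ->
  perm_eq (net_a R a (flip sigma))
    (grid_points R m (scrambled_grid (fun t => ~~ psi_a (flip_a a) (shift_a sigma) t) m)).
Proof.
move=> m0; have := perm_net_a R a (flip sigma) m0.
have sE n : shift_a (flip sigma) n = ~~ shift_a sigma n.
  rewrite /shift_a /flip /digit /= (nth_map false) // size_tuple.
  by have := leq_subr n m; lia.
have -> : psi_a (flip_a a) (shift_a (flip sigma)) =
    (fun t => ~~ psi_a (flip_a a) (shift_a sigma) t).
  by apply/funext => t; rewrite /psi_a sE addbN.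
by [].
Qed.

Lemma perm_net_sym m (a : m.-1.-tuple bool) (sigma : m.-tuple bool) : (0 < m)%N ->
  perm_eq (net_sym R a sigma) (grid_points R m
    (scrambled_grid (psi_a (flip_a a) (shift_a sigma)) m ++
     scrambled_grid (fun t => ~~ psi_a (flip_a a) (shift_a sigma) t) m)).
Proof.
move=> m0; rewrite /grid_points map_cat.
by apply: perm_cat; [exact: perm_net_a|exact: perm_net_flip].
Qed.

Lemma perm_net_c m (c : m.-1.-tuple bool) : (0 < m)%N ->
  perm_eq (net_c R c) (grid_points R m
    (scrambled_grid (fun t => digit c (m - size t) && parity t) m)).
Proof.
move=> m0; apply: (@perm_net R _ _ (fun t k =>
     if (k < m)%N then
       digit t k (+) (digit c k && \big[addb/false]_(k.+1 <= j < m.+1) digit t j)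
     else digit t m)) => t st k /andP[k0 km].
rewrite nth_scramble ?prednK ?st // size_drop st subKn //.
have [h|h] := ltnP k m; first by rewrite parityE st.
have -> : k = m by apply/eqP; rewrite eqn_leq km.
by rewrite drop_oversize ?st // andbF addbF.
Qed.

Lemma perm_net_1 m : (0 < m)%N ->
  perm_eq (net_1 R m) (grid_points R m (scrambled_grid parity m)).
Proof.
move=> m0; apply: (@perm_net R _ _ (fun t k =>
     if (k < m)%N then
       digit t k (+) (digit [tuple of nseq m.-1 true] k &&
         \big[addb/false]_(k.+1 <= j < m.+1) digit t j)
     else digit t m)) => t st k /andP[k0 km].
rewrite nth_scramble ?prednK ?st //.
have [h|h] := ltnP k m.
  rewrite parityE st /digit -[tval _]/(nseq m.-1 true) nth_nseq ifT //.
  by move: h k0; lia.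
have -> : k = m by apply/eqP; rewrite eqn_leq km.
by rewrite drop_oversize ?st // addbF.
Qed.

(** * Closed forms of the L2 values *)

Lemma coef_single n : cst_coef (fun=> 1) n = n%:R / 48 + (1 - (4 ^+ n)^-1) / 72 :> R.
Proof.
have q k : quad_coef (fun=> 1) k = (1 - (4 ^+ k)^-1) / 12 :> R.
  elim: k => [|k IH] /=; first by rewrite expr0 invr1; ring.
  by rewrite IH exprS invfM; field; rewrite expf_neq0.
elim: n => [|n IH] /=; first by rewrite expr0 invr1; ring.
by rewrite IH q -natr1 exprS invfM; field; rewrite expf_neq0.
Qed.

(** The index is n + 1 because q_0 = 0: the symmetrized walk starts one digit later. *)
Lemma coef_sym n :
  cst_coef (fun k => if (0 < k)%N then 2 else 0) n.+1 =
  n%:R / 24 + (1 - (4 ^+ n)^-1) / 36 :> R.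
Proof.
have q k : quad_coef (fun k => if (0 < k)%N then 2 else 0) k.+1 = (1 - (4 ^+ k)^-1) / 6 :> R.
  elim: k => [|k IH]; first by rewrite /= expr0 invr1; ring.
  by rewrite /= in IH *; rewrite IH exprS invfM; field; rewrite expf_neq0.
elim: n => [|n IH]; first by rewrite /= expr0 invr1; ring.
have -> (f : nat -> R) k : cst_coef f k.+1 = cst_coef f k - quad_coef f k / 8 + f k / 32 by [].
by rewrite IH q /= -natr1 exprS invfM; field; rewrite expf_neq0.
Qed.

Lemma sum_mean_base n : \sum_(0 <= k < n) (1 / 3 + 2 / (3 * 4 ^+ k)) =
  n%:R / 3 + 8 / 9 * (1 - (4 ^+ n)^-1) :> R.
Proof.
elim: n => [|n IH]; first by rewrite big_geq // expr0 invr1; ring.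
by rewrite big_nat_recr //= IH -natr1 exprS; field; rewrite expf_neq0.
Qed.

Lemma extr_discrepancy_parity m :
  (extr_discrepancy 2 (grid_points R m (scrambled_grid parity m)) ^+ 2)%E =
  (m%:R / 64 + 1 / 72 - 1 / (9 * 4 ^+ (m + 2)))%:E.
Proof.
rewrite (grid_net_L2 (grid_net_scramble R parity m) (q := fun=> 1)
  (r := fun k => 1 / 3 + 2 / (3 * 4 ^+ k))); last 2 first.
- by move=> k; rewrite theta_sqr mulr1.
- exact: theta_parity_mean.
congr EFin; rewrite coef_single sum_mean_base exprD; field.
by rewrite expf_neq0.
Qed.

Lemma rev_digits m (a : m.-1.-tuple bool) (F : nat -> R) :
  \sum_(1 <= n < m) (flip_a a n)%:R * F n = \sum_(1 <= k < m) (digit a k)%:R * F (m - k)%N.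
Proof.
rewrite big_nat_rev /=; apply: eq_big_nat => k /andP[k1 km].
rewrite /flip_a add1n subSS; congr (_%:R * _).
by rewrite subKn // ltnW.
Qed.

(** Setting a_k = 1 lowers r_n, for n = m - k, by (1 - 4 / 4^n) / 3, and r enters with the factor -
    1/64. At n = 1 the change is zero, so the sum ends at k = m - 2. *)
Lemma extr_discrepancy_a m (a : m.-1.-tuple bool) (S : nat -> bool) : (0 < m)%N ->
  (extr_discrepancy 2 (grid_points R m (scrambled_grid (psi_a (flip_a a) S) m)) ^+ 2)%E =
  (m%:R / 64 + 1 / 72 - 1 / (9 * 4 ^+ (m + 2))
   + 1 / 192 * \sum_(1 <= k < m.-1)
       (digit a k)%:R * (1 - 2 ^ (2 * k%:Z - 2 * m%:Z + 2)))%:E.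
Proof.
move=> m0.
rewrite (grid_net_L2 (grid_net_scramble R (psi_a (flip_a a) S) m) (q := fun=> 1)
  (r := fun n => if flip_a a n && (0 < n)%N then 2 / 4 ^+ n else 1 / 3 + 2 / (3 * 4 ^+ n)));
  last 2 first.
- by move=> k; rewrite theta_sqr mulr1.
- exact: theta_a_mean.
congr EFin.
have -> : \sum_(0 <= n < m) (if flip_a a n && (0 < n)%N then 2 / 4 ^+ n
      else 1 / 3 + 2 / (3 * 4 ^+ n)) =
    \sum_(0 <= n < m) (1 / 3 + 2 / (3 * 4 ^+ n))
    - \sum_(1 <= n < m) (flip_a a n)%:R * ((1 - 4 / 4 ^+ n) / 3) :> R.
  rewrite !(big_ltn m0) andbF -[RHS]addrA; congr (_ + _); rewrite -sumrB.
  apply: eq_big_nat => n /andP[n1 _]; rewrite n1 andbT.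
  by case: (flip_a a n); rewrite ?mulr0n ?mulr1n; field; rewrite expf_neq0.
have -> : \sum_(1 <= n < m) (flip_a a n)%:R * ((1 - 4 / 4 ^+ n) / 3) =
    1 / 3 * \sum_(1 <= k < m.-1) (digit a k)%:R * (1 - 2 ^ (2 * k%:Z - 2 * m%:Z + 2)) :> R.
  rewrite (rev_digits a (fun n => (1 - 4 / 4 ^+ n) / 3)) mulr_sumr.
  have E k : (k < m)%N -> 2 ^ (2 * k%:Z - 2 * m%:Z + 2) = 4 / 4 ^+ (m - k) :> R.
    move=> km; have -> : 2 * k%:Z - 2 * m%:Z + 2 = 2 - (2 * (m - k))%N%:Z by lia.
    have t0 : 2 != 0 :> R by [].
    rewrite expfzDr // -exprnN exprM.
    by congr (_ / _ ^+ _); rewrite -?exprnP; ring.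
  case: m m0 a E {S} => [//|[|m]] _ a E /=; first by rewrite !big_geq.
  rewrite big_nat_recr //= subSnn expr1 divff // subrr mul0r mulr0 addr0.
  apply: eq_big_nat => k /andP[k1 km]; rewrite E; last by rewrite ltnW.
  ring.
rewrite coef_single sum_mean_base exprD; set T := \sum_(1 <= k < _) _.
by field; rewrite expf_neq0.
Qed.

(** Here r_n = 8 / 4^n where a_(m-n) = 1 and n > 0, and 8 / (64 4^(m-k)) = 2^(2k) / 2^(2m+3). *)
Lemma extr_discrepancy_sym m (a : m.-1.-tuple bool) (S : nat -> bool) : (0 < m)%N ->
  (extr_discrepancy 2 (grid_points R m (scrambled_grid (psi_a (flip_a a) S) m ++
     scrambled_grid (fun t => ~~ psi_a (flip_a a) S t) m)) ^+ 2)%E =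
  ((m%:R + 1) / 24 - 5 / (9 * 4 ^+ (m + 1))
   - 1 / 2 ^+ (2 * m + 3) * \sum_(1 <= k < m) (digit a k)%:R * 2 ^+ (2 * k))%:E.
Proof.
move=> m0.
rewrite (grid_net_L2 (grid_net_cat (grid_net_scramble R (psi_a (flip_a a) S) m)
    (grid_net_scramble R (fun t => ~~ psi_a (flip_a a) S t) m))
  (q := fun k => if (0 < k)%N then 2 else 0)
  (r := fun n => if flip_a a n && (0 < n)%N then 8 / 4 ^+ n else 0)); last 2 first.
- by move=> k; exact: sym_theta_sqr.
- by move=> k; exact: theta_sym_mean.
congr EFin.
have -> : \sum_(0 <= n < m) (if flip_a a n && (0 < n)%N then 8 / 4 ^+ n else 0) =
    8 / 4 ^+ m * \sum_(1 <= k < m) (digit a k)%:R * 2 ^+ (2 * k) :> R.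
  rewrite (big_ltn m0) andbF add0r.
  rewrite (eq_big_nat _ _ (F2 := fun n => (flip_a a n)%:R * (8 / 4 ^+ n))); last first.
    by move=> n /andP[n1 _]; rewrite n1 andbT; case: (flip_a a n); rewrite ?mul1r ?mul0r.
  rewrite (rev_digits a (fun n => 8 / 4 ^+ n)) mulr_sumr; apply: eq_big_nat => k /andP[_ km].
  rewrite exprM (_ : 2 ^+ 2 = 4 :> R); last by ring.
  have -> : 4 ^+ m = 4 ^+ k * 4 ^+ (m - k) :> R by rewrite -exprD subnKC // ltnW.
  by field; rewrite !expf_neq0.
rewrite exprD exprD exprM (_ : 2 ^+ 2 = 4 :> R); last by ring.
set T := \sum_(1 <= k < _) _.
rewrite -(prednK m0) coef_sym -natr1 exprS.
by field; rewrite expf_neq0.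
Qed.

End Nets.

Lemma sqrt_ln_pow2 (R : realType) (m : nat) :
  Num.sqrt (ln (2 ^+ m)) = Num.sqrt (ln 2) * Num.sqrt m%:R :> R.
Proof. by rewrite lnXn // -[ln 2 *+ m]mulr_natr sqrtrM // ln_ge0 // ler1n. Qed.

(* In the first formula the summand is a_k (1 - 2^(2k-2m+2)).  The printed
   source has a_k (2 - 2^(2k-2m+2)), which is a misprint: for m = 3 and a_1 = 1
   the squared discrepancy is 595/9216, whereas the printed value is 643/9216. *)
Theorem theorem8 (R : realType) :
  [/\ forall (m : nat) (a : m.-1.-tuple bool) (sigma : m.-tuple bool),
        (0 < m)%N ->
        (extr_discrepancy 2 (net_a R a sigma) ^+ 2)%E =
        (m%:R / 64 + 1 / 72 - 1 / (9 * 4 ^+ (m + 2))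
         + 1 / 192 * \sum_(1 <= k < m.-1)
             (digit a k)%:R * (1 - 2 ^ (2 * k%:Z - 2 * m%:Z + 2)))%:E,
      forall (m : nat) (a : m.-1.-tuple bool) (sigma : m.-tuple bool),
        (0 < m)%N ->
        (extr_discrepancy 2 (net_sym R a sigma) ^+ 2)%E =
        ((m%:R + 1) / 24 - 5 / (9 * 4 ^+ (m + 1))
         - 1 / 2 ^+ (2 * m + 3) * \sum_(1 <= k < m)
             (digit a k)%:R * 2 ^+ (2 * k))%:E,
      forall m : nat, (0 < m)%N ->
        (extr_discrepancy 2 (net_1 R m) ^+ 2)%E =
        (m%:R / 64 + 1 / 72 - 1 / (9 * 4 ^+ (m + 2)))%:E
    & forall p : R, 1 < p ->
        exists C : R, 0 < C /\
        forall (m : nat) (a : m.-1.-tuple bool) (sigma : m.-tuple bool)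
               (c : m.-1.-tuple bool),
          (0 < m)%N ->
          [/\ (extr_discrepancy p (net_a R a sigma)
                 <= (C * Num.sqrt (ln (2 ^+ m)))%:E)%E,
              (extr_discrepancy p (net_c R c)
                 <= (C * Num.sqrt (ln (2 ^+ m)))%:E)%E
            & (extr_discrepancy p (net_sym R a sigma)
                 <= (C * Num.sqrt (ln (2 ^+ (m + 1))))%:E)%E]].
Proof.
split.
- move=> m a sigma m0; rewrite (perm_extr_discrepancy _ (perm_net_a R a sigma m0)).
  exact: extr_discrepancy_a.
- move=> m a sigma m0; rewrite (perm_extr_discrepancy _ (perm_net_sym R a sigma m0)).
  exact: extr_discrepancy_sym.
- move=> m m0; rewrite (perm_extr_discrepancy _ (perm_net_1 R m0)).
  exact: extr_discrepancy_parity.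
move=> p p1.
pose K (w : R) := (8 * expR 1 * (4 `^ p * p `^ p * expR (2 * w))) `^ p^-1.
have p0 : 0 < p by lra.
have K0 w : 0 < K w.
  by rewrite powR_gt0 // !mulr_gt0 ?expR_gt0 // powR_gt0.
pose l : R := Num.sqrt (ln 2).
have l0 : 0 < l by rewrite sqrtr_gt0 ln_gt0 // ltr1n.
(* K is taken at w = 1 for single nets and at w = 2 for the symmetrized one; dividing by sqrt (ln 2)
   converts sqrt m into sqrt (ln 2^m). *)
exists ((K 1 + K (1 + 1)) / l); split; first by rewrite divr_gt0 // addr_gt0.
move=> m a sigma c m0.
have bound (w : R) (k : nat) : (m <= k)%N -> K w <= K 1 + K (1 + 1) ->
    K w * Num.sqrt m%:R <= (K 1 + K (1 + 1)) / l * Num.sqrt (ln (2 ^+ k)).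
  move=> mk hw; rewrite sqrt_ln_pow2 -/l mulrA divfK ?gt_eqF //.
  by apply: ler_pM => //; rewrite ?sqrtr_ge0 ?ler_wsqrtr ?ler_nat // ltW.
have K1 : K 1 <= K 1 + K (1 + 1) by rewrite lerDl ltW.
have K2 : K (1 + 1) <= K 1 + K (1 + 1) by rewrite lerDr ltW.
have single psi : (extr_discrepancy p (grid_points R m (scrambled_grid psi m)) <=
    ((K 1 + K (1 + 1)) / l * Num.sqrt (ln (2 ^+ m)))%:E)%E.
  apply: le_trans (grid_net_Lp m0 (grid_net_scramble R psi m) _ p1) _.
    by move=> t e; rewrite net_theta_norm ler1n.
  by rewrite lee_fin; exact: bound.
split.
- by rewrite (perm_extr_discrepancy _ (perm_net_a R a sigma m0)).
- by rewrite (perm_extr_discrepancy _ (perm_net_c R c m0)).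
rewrite (perm_extr_discrepancy _ (perm_net_sym R a sigma m0)).
apply: le_trans (grid_net_Lp m0 (grid_net_cat (grid_net_scramble R _ m)
  (grid_net_scramble R _ m)) _ p1) _.
  by move=> t e; exact: sym_theta_norm.
by rewrite lee_fin; apply: bound => //; rewrite addn1.
Qed.
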